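(* Let $W\subset \mathrm{GL}(V)$ be a reflection group and let $\zeta$ be a primitive $d^{\text{th}}$ root of unity. Then $$E(W,\zeta)=\{E\cap X\ :\ X\in \mathscr L_W\ \text{and}\ E\in E(W,\zeta)\ \text{maximal}\},$$ where ''maximal'' means maximal under inclusion. In particular, each upper interval $[x,\hat 1]$ in $E(W,\zeta)$ is a geometric lattice.
   Context: $V$ is a finite-dimensional $\mathbb C$-vector space. A reflection in $V$ is a non-identity element of $\mathrm{GL}(V)$ of finite order that fixes some hyperplane (its reflecting hyperplane) pointwise; a reflection group is a finite subgroup $W\subset\mathrm{GL}(V)$ generated by reflections. For $g\in W$, $V(g,\zeta)=\{v\in V: gv=\zeta v\}$. $E(W,\zeta)$ is the poset of all subspaces $V(g,\zeta)$, $g\in W$, ordered by reverse inclusion; $\hat 1$ denotes its top element. $\mathscr L_W$ is the lattice of all intersections of reflecting hyperplanes of $W$ (including the empty intersection $V$), ordered by reverse inclusion; equivalently $\mathscr L_W=E(W,1)$. *)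

(* Defs.v *)
From mathcomp Require Import all_boot all_order all_algebra.
From mathcomp Require Import boolp classical_sets functions cardinality reals.
From mathcomp Require Import complex.

Set Implicit Arguments.
Unset Strict Implicit.
Unset Printing Implicit Defensive.

Import Order.TTheory GRing.Theory Num.Theory.
Local Open Scope classical_set_scope.
Local Open Scope ring_scope.

(* In what follows a poset is a subset A of a type T with a relation le;
   joins, meets, covers, and so on are taken inside A. *)

Definition partial_order_on (T : Type) (le : T -> T -> Prop) (A : set T) :
    Prop :=
  [/\ forall x, A x -> le x x,
      forall x y, A x -> A y -> le x y -> le y x -> x = y
    & forall x y z, A x -> A y -> A z -> le x y -> le y z -> le x z].

Definition is_bottom (T : Type) (le : T -> T -> Prop) (A : set T) (b : T) :
    Prop :=
  A b /\ forall x, A x -> le b x.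

Definition is_top (T : Type) (le : T -> T -> Prop) (A : set T) (t : T) :
    Prop :=
  A t /\ forall x, A x -> le x t.

Definition interval_in (T : Type) (le : T -> T -> Prop) (A : set T)
    (x y : T) : set T :=
  [set z | [/\ A z, le x z & le z y]].

Definition is_join (T : Type) (le : T -> T -> Prop) (A S : set T) (j : T) :
    Prop :=
  [/\ A j, forall s, S s -> le s j
    & forall u, A u -> (forall s, S s -> le s u) -> le j u].

Definition is_meet (T : Type) (le : T -> T -> Prop) (A S : set T) (m : T) :
    Prop :=
  [/\ A m, forall s, S s -> le m s
    & forall l, A l -> (forall s, S s -> le l s) -> le l m].

Definition is_lattice (T : Type) (le : T -> T -> Prop) (A : set T) : Prop :=
  partial_order_on le A /\
  forall x y, A x -> A y ->
    (exists j, is_join le A [set x; y] j) /\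
    (exists m, is_meet le A [set x; y] m).

Definition covers (T : Type) (le : T -> T -> Prop) (A : set T) (x y : T) :
    Prop :=
  [/\ A x, A y, le x y, x <> y
    & forall z, A z -> le x z -> le z y -> z = x \/ z = y].

Definition is_atom (T : Type) (le : T -> T -> Prop) (A : set T) (a : T) :
    Prop :=
  exists2 b, is_bottom le A b & covers le A b a.

(* Every element is a join of atoms; the bottom is the join of none. *)
Definition atomistic (T : Type) (le : T -> T -> Prop) (A : set T) : Prop :=
  forall x, A x -> exists2 S, S `<=` is_atom le A & is_join le A S x.

Definition is_rank_function (T : Type) (le : T -> T -> Prop) (A : set T)
    (rk : T -> nat) : Prop :=
  (forall b, is_bottom le A b -> rk b = 0%N) /\
  (forall x y, covers le A x y -> rk y = (rk x).+1).

Definition semimodular (T : Type) (le : T -> T -> Prop) (A : set T) : Prop :=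
  exists2 rk : T -> nat, is_rank_function le A rk &
    forall x y j m, A x -> A y ->
      is_join le A [set x; y] j -> is_meet le A [set x; y] m ->
      (rk m + rk j <= rk x + rk y)%N.

Definition geometric_lattice (T : Type) (le : T -> T -> Prop) (A : set T) :
    Prop :=
  [/\ finite_set A, A !=set0, is_lattice le A, atomistic le A
    & semimodular le A].

Definition is_subgroup_GL (K : fieldType) (V : vectType K)
    (W : set 'End(V)) : Prop :=
  [/\ W \1%VF,
      forall g h, W g -> W h -> W (g \o h)%VF
    & forall g, W g -> lker g = 0%VS /\ W (g^-1)%VF].

Definition is_hyperplane (K : fieldType) (V : vectType K) (H : {vspace V}) :
    Prop :=
  (\dim H).+1 = \dim {: V}.

Definition fixes_pointwise (K : fieldType) (V : vectType K) (g : 'End(V))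
    (H : {vspace V}) : Prop :=
  forall v, v \in H -> g v = v.

Definition is_reflection (K : fieldType) (V : vectType K) (g : 'End(V)) :
    Prop :=
  [/\ lker g = 0%VS, g <> \1%VF,
      exists2 n, (0 < n)%N & forall v, iter n g v = v
    & exists2 H, is_hyperplane H & fixes_pointwise g H].

(* The last clause says that the reflections in W generate W. *)
Definition is_reflection_group (K : fieldType) (V : vectType K)
    (W : set 'End(V)) : Prop :=
  [/\ is_subgroup_GL W, finite_set W
    & forall G : set 'End(V), is_subgroup_GL G ->
        W `&` @is_reflection K V `<=` G -> W `<=` G].

Definition reflecting_hyperplane (K : fieldType) (V : vectType K)
    (W : set 'End(V)) (H : {vspace V}) : Prop :=
  is_hyperplane H /\
  exists g, [/\ W g, is_reflection g & fixes_pointwise g H].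

(* Finite families of hyperplanes suffice since W is finite; the empty
   sequence gives the whole space. *)
Definition intersection_lattice (K : fieldType) (V : vectType K)
    (W : set 'End(V)) : set {vspace V} :=
  [set X | exists2 s : seq {vspace V},
     (forall H, H \in s -> reflecting_hyperplane W H)
     & X = (\bigcap_(H <- s) H)%VS].

Definition eigenspaces (K : fieldType) (V : vectType K) (W : set 'End(V))
    (zeta : K) : set {vspace V} :=
  [set passmx.leigenspace g zeta | g in W].

Definition maximal_eigenspace (K : fieldType) (V : vectType K)
    (W : set 'End(V)) (zeta : K) (E : {vspace V}) : Prop :=
  eigenspaces W zeta E /\
  forall F, eigenspaces W zeta F -> (E <= F)%VS -> F = E.

Definition rev_incl (K : fieldType) (V : vectType K) (U U' : {vspace V}) :
    Prop :=
  (U' <= U)%VS.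

(* Main.v *)
(** For a maximal eigenspace E = V(h, zeta) containing F = V(g, zeta), F is the
    intersection of E with the fixed space of g^-1 h, so one inclusion is the
    equality L_W = E(W, 1), which is Steinberg's theorem on stabilizers.
    Conversely, if s in W is a reflection with hyperplane H not containing
    V(g, zeta), orthogonality for a W-invariant hermitian form gives
    V(gs, zeta) = V(g, zeta) /\ H. So the interval above F is the intersection
    lattice of the arrangement induced on F by the reflecting hyperplanes.

    Steinberg's theorem is proved as follows. Let S be the ring of polynomial
    functions and A its W-invariants; by Chevalley, S is a free A-module. Let u
    be a point, X the intersection of the reflecting hyperplanes through u and
    suppose some w in W fixes u but moves x in X. Differentiation at u along
    y = x - w x in X kills A, hence is evaluation at u of an A-linear map
    T : S -> A. Let Q be the pointwise stabilizer of X. By Lagrange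
    interpolation, T is f |-> tr (f r / h) on the Q-invariants, for many
    denominators h. One of them is a product of linear forms, and the linear
    factors vanishing at u can be cancelled: a generic point of such a
    hyperplane has its stabilizer in Q, hence lies off another denominator. So
    one may take h with h(u) <> 0, and then T(f h)(u) depends only on the values
    of f on the orbit of u, contradicting that T(f h)(u) is a derivative. *)

Require Import Defs.
From HB Require Import structures.
From mathcomp Require Import all_boot all_order all_algebra.
From mathcomp Require Import boolp classical_sets functions cardinality reals.
From mathcomp Require Import complex ring zify.

Set Implicit Arguments.
Unset Strict Implicit.
Unset Printing Implicit Defensive.

Import Order.TTheory GRing.Theory Num.Theory.
Local Open Scope classical_set_scope.
Local Open Scope ring_scope.

(** * Polynomial functions on a vector space *)

Lemma poly_fun_inj (K : numFieldType) (p q : {poly K}) :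
  (forall t, p.[t] = q.[t]) -> p = q.
Proof.
move=> pq; apply/eqP; rewrite -subr_eq0; apply/negPn/negP => nz.
pose r := [seq i%:R | i <- iota 0 (size (p - q))] : seq K.
suff : (size r < size (p - q)%R)%N by rewrite size_map size_iota ltnn.
apply: max_poly_roots => //.
  by apply/allP => x _; rewrite rootE hornerD hornerN pq subrr.
by rewrite map_inj_uniq ?iota_uniq // => i j /eqP; rewrite eqr_nat => /eqP.
Qed.

Section PolynomialFunctions.
Variables (K : numFieldType) (V : vectType K).
Implicit Types (f g h l b : V -> K) (u v x y : V) (s t : K).

Definition linform (l : V -> K) := forall a x y, l (a *: x + y) = a * l x + l y.

(** The ring S of polynomial functions, presented without coordinates so that stability under linear
    substitution is a direct induction. *)
Inductive polyfun : (V -> K) -> Prop :=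
| polyfun_cst c : polyfun (fun=> c)
| polyfun_lin l of linform l : polyfun l
| polyfun_add f g of polyfun f & polyfun g : polyfun (fun v => f v + g v)
| polyfun_mul f g of polyfun f & polyfun g : polyfun (fun v => f v * g v).

Lemma polyfun_ext f g : polyfun f -> (forall v, f v = g v) -> polyfun g.
Proof. by move=> pf /funext <-. Qed.

Lemma polyfun_scale c f : polyfun f -> polyfun (fun v => c * f v).
Proof. by move=> pf; apply: polyfun_mul => //; exact: polyfun_cst. Qed.

Lemma polyfun_opp f : polyfun f -> polyfun (fun v => - f v).
Proof.
by move=> pf; apply: polyfun_ext (polyfun_scale (-1) pf) _ => v; rewrite mulN1r.
Qed.

Lemma polyfun_sub f g : polyfun f -> polyfun g -> polyfun (fun v => f v - g v).
Proof. by move=> pf pg; apply: polyfun_add => //; exact: polyfun_opp. Qed.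

Lemma polyfun_sum (I : Type) (r : seq I) (P : pred I) (F : I -> V -> K) :
  (forall i, P i -> polyfun (F i)) -> polyfun (fun v => \sum_(i <- r | P i) F i v).
Proof.
move=> pF; elim: r => [|i r IH].
  by apply: polyfun_ext (polyfun_cst 0) _ => v; rewrite big_nil.
case Pi: (P i); last by apply: polyfun_ext IH _ => v; rewrite big_cons Pi.
by apply: polyfun_ext (polyfun_add (pF _ Pi) IH) _ => v; rewrite big_cons Pi.
Qed.

Lemma polyfun_prod (I : Type) (r : seq I) (P : pred I) (F : I -> V -> K) :
  (forall i, P i -> polyfun (F i)) -> polyfun (fun v => \prod_(i <- r | P i) F i v).
Proof.
move=> pF; elim: r => [|i r IH].
  by apply: polyfun_ext (polyfun_cst 1) _ => v; rewrite big_nil.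
case Pi: (P i); last by apply: polyfun_ext IH _ => v; rewrite big_cons Pi.
by apply: polyfun_ext (polyfun_mul (pF _ Pi) IH) _ => v; rewrite big_cons Pi.
Qed.

Lemma linformD l x y : linform l -> l (x + y) = l x + l y.
Proof. by move=> ll; have := ll 1 x y; rewrite scale1r mul1r. Qed.

Lemma linform0 l : linform l -> l 0 = 0.
Proof. by move=> ll; apply: (@addrI _ (l 0)); rewrite -linformD // !addr0. Qed.

Lemma linformZ l a x : linform l -> l (a *: x) = a * l x.
Proof. by move=> ll; have := ll a x 0; rewrite addr0 (linform0 ll) addr0. Qed.

Lemma linformB l x y : linform l -> l (x - y) = l x - l y.
Proof. by move=> ll; rewrite -scaleN1r linformD // linformZ // mulN1r. Qed.

Lemma linform_comp l (phi : {linear V -> V}) :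
  linform l -> linform (fun v => l (phi v)).
Proof. by move=> ll a x y; rewrite linearP ll. Qed.

Lemma polyfun_comp f (phi : {linear V -> V}) :
  polyfun f -> polyfun (fun v => f (phi v)).
Proof.
elim=> [c|l ll|f1 g1 _ IH1 _ IH2|f1 g1 _ IH1 _ IH2].
- exact: polyfun_cst.
- exact/polyfun_lin/linform_comp.
- exact: polyfun_add IH1 IH2.
- exact: polyfun_mul IH1 IH2.
Qed.

Lemma linform_coord (n : nat) (X : n.-tuple V) (i : 'I_n) :
  linform (fun v => coord X i v).
Proof. by move=> a x y; rewrite linearP. Qed.

Lemma linform_neq0 x : x != 0 -> exists2 l, linform l & l x = 1.
Proof.
move=> x0.
have [i xi] : exists i, coord (vbasis {:V}) i x != 0.
  apply/existsP; rewrite -negb_forall; apply: contra x0 => /forallP cx0.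
  rewrite (coord_vbasis (memvf x)) big1 // => i _.
  by rewrite (eqP (cx0 i)) scale0r.
exists (fun v => (coord (vbasis {:V}) i x)^-1 * coord (vbasis {:V}) i v).
  by move=> a y z; rewrite linform_coord; ring.
by rewrite mulVf.
Qed.

Lemma linform_neq x y : x != y -> exists2 l, linform l & l x != l y.
Proof.
rewrite -subr_eq0 => /linform_neq0 [l ll lxy]; exists l => //.
by rewrite -subr_eq0 -linformB // lxy oner_eq0.
Qed.

Lemma line_subproof f u y : polyfun f ->
  exists p : {poly K}, forall t, p.[t] = f (u + t *: y).
Proof.
elim=> [c|l ll|f1 g1 _ [p pE] _ [q qE]|f1 g1 _ [p pE] _ [q qE]].
- by exists c%:P => t; rewrite hornerC.
- exists ((l u)%:P + l y *: 'X) => t; rewrite !hornerE.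
  by rewrite linformD // linformZ // mulrC.
- by exists (p + q) => t; rewrite hornerD pE qE.
- by exists (p * q) => t; rewrite hornerM pE qE.
Qed.

(** The restriction of [f] to a line, as a univariate polynomial, with junk value 0 if there is
    none. It serves to use that [{poly K}] is a domain, to define homogeneous components ([u = 0])
    and directional derivatives at [u] (coefficient 1). *)
Definition line f u y : {poly K} :=
  xget 0 [set p : {poly K} | forall t, p.[t] = f (u + t *: y)].

Lemma lineE f u y t : polyfun f -> (line f u y).[t] = f (u + t *: y).
Proof. by move=> /(line_subproof u y)[p pE]; rewrite /line; case: xgetP => [q -> -> //|/(_ p)]. Qed.

Lemma line_uniq f u y p : (forall t, p.[t] = f (u + t *: y)) -> line f u y = p.
Proof.
move=> pE; apply: poly_fun_inj => t; rewrite pE /line.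
by case: xgetP => [q -> -> //|/(_ p)].
Qed.

Lemma line_mul f g u y : polyfun f -> polyfun g ->
  line (fun v => f v * g v) u y = line f u y * line g u y.
Proof. by move=> pf pg; apply: line_uniq => t; rewrite hornerM !lineE. Qed.

Lemma line_sum (I : Type) (r : seq I) (P : pred I) (F : I -> V -> K) u y :
  (forall i, P i -> polyfun (F i)) ->
  line (fun v => \sum_(i <- r | P i) F i v) u y = \sum_(i <- r | P i) line (F i) u y.
Proof.
move=> pF; apply: line_uniq => t; rewrite horner_sum.
by apply: eq_bigr => i Pi; rewrite lineE //; exact: pF.
Qed.

Lemma line_coef0 f u y : polyfun f -> (line f u y)`_0 = f u.
Proof. by move=> pf; rewrite -horner_coef0 lineE // scale0r addr0. Qed.

(** Restrict to the line joining a point where [f] is nonzero to a point where [g] is nonzero. *)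
Lemma polyfun_mul_eq0 f g : polyfun f -> polyfun g ->
  (forall v, f v * g v = 0) -> (forall v, f v = 0) \/ (forall v, g v = 0).
Proof.
move=> pf pg fg0; apply/or_asboolP; rewrite -[_ || _]negbK negb_or.
apply/negP => /andP[/asboolPn/existsNP[x /eqP fx] /asboolPn/existsNP[y /eqP gy]].
have : line f x (y - x) * line g x (y - x) = 0.
  by apply: poly_fun_inj => t; rewrite hornerM !lineE // fg0 horner0.
move/eqP; rewrite mulf_eq0 => /orP[]/eqP l0.
  by move: fx; rewrite -(line_coef0 x (y - x) pf) l0 coef0 eqxx.
by move: gy; rewrite -(subrKC x y) -[X in x + X]scale1r -lineE // l0 horner0 eqxx.
Qed.

Lemma polyfun_cancel h f g : polyfun h -> polyfun f -> polyfun g ->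
  ~ (forall v, h v = 0) -> (forall v, h v * f v = h v * g v) ->
  forall v, f v = g v.
Proof.
move=> ph pf pg h0 hfg.
case: (@polyfun_mul_eq0 h (fun v => f v - g v)) => //.
- exact: polyfun_sub.
- by move=> v; rewrite mulrBr hfg subrr.
- by move=> fg0 v; apply/eqP; rewrite -subr_eq0 fg0.
Qed.

Lemma generic_point (I : eqType) (r : seq I) (F : I -> V -> K) :
  (forall i, i \in r -> polyfun (F i)) ->
  (forall i, i \in r -> exists v, F i v != 0) ->
  exists v, forall i, i \in r -> F i v != 0.
Proof.
move=> pF nF; suff [v vP] : exists v, \prod_(i <- r) F i v != 0.
  exists v => i ir; apply: contra vP => /eqP Fi0.
  by rewrite (big_rem i ir) /= Fi0 mul0r.
elim: r pF nF => [|i r IH] pF nF.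
  by exists 0; rewrite big_nil oner_eq0.
have [j jr|j jr|v vP] := IH.
- by apply: pF; rewrite inE jr orbT.
- by apply: nF; rewrite inE jr orbT.
apply: contrapT => no.
have pi := pF _ (mem_head i r).
have pr : polyfun (fun v => \prod_(i <- r) F i v).
  apply: polyfun_ext (_ : polyfun (fun v => \prod_(i <- r | i \in r) F i v)) _.
    by apply: polyfun_prod => j jr; apply: pF; rewrite inE jr orbT.
  by move=> w; rewrite [RHS]big_seq.
case: (polyfun_mul_eq0 pi pr).
- move=> w; apply/eqP/negPn/negP => nw; apply: no; exists w; by rewrite big_cons.
- by move=> i0; have [w] := nF _ (mem_head i r); rewrite i0 eqxx.
- by move=> r0; rewrite r0 eqxx in vP.
Qed.

(** A difference quotient, with a twisted Leibniz rule for products. Taken between a reflection and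
    the identity it gives the operators of Chevalley's argument; between the identity and a
    projection onto the kernel of [b], the factor theorem. *)
Lemma polyfun_sub_comp_dvd f (phi psi : {linear V -> V}) b rho : polyfun f ->
  (forall v, phi v - psi v = b v *: rho) ->
  exists2 g, polyfun g & forall v, f (phi v) - f (psi v) = b v * g v.
Proof.
move=> pf pb; elim: pf => [c|l ll|f1 g1 p1 [f2 p2 E2] q1 [g2 q2 F2]|f1 g1 p1 [f2 p2 E2] q1 [g2 q2 F2]].
- by exists (fun=> 0) => [|v]; [exact: polyfun_cst|rewrite subrr mulr0].
- exists (fun=> l rho) => [|v]; first exact: polyfun_cst.
  by rewrite -linformB // pb linformZ.
- exists (fun v => f2 v + g2 v) => [|v]; first exact: polyfun_add.
  by rewrite mulrDr -E2 -F2; ring.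
- exists (fun v => f2 v * g1 (phi v) + f1 (psi v) * g2 v) => [|v].
    by apply: polyfun_add; apply: polyfun_mul => //; exact: polyfun_comp.
  by rewrite mulrDr mulrA -E2 mulrCA -F2; ring.
Qed.

Lemma linform_proj b : linform b -> ~ (forall v, b v = 0) ->
  exists (pi : {linear V -> V}) (e : V), [/\ forall v, v - pi v = b v *: e,
    forall v, b (pi v) = 0 & forall v, b v = 0 -> pi v = v].
Proof.
move=> lb /existsNP[e0 /eqP be0].
pose e := (b e0)^-1 *: e0; have be : b e = 1 by rewrite linformZ // mulVf.
pose pif (v : V) := v - b v *: e.
have pi_lin : linear pif.
  move=> a x y; rewrite /pif lb scalerDl scalerBr -scalerA.
  by rewrite opprD -!addrA; congr (_ + _); rewrite addrCA.
pose piL := GRing.isLinear.Build K V V *:%R pif pi_lin.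
pose pi : {linear V -> V} := HB.pack pif piL.
exists pi, e; split=> v /=.
- by rewrite /pif opprB addrC subrK.
- by rewrite /pif linformB // linformZ // be mulr1 subrr.
- by rewrite /pif => ->; rewrite scale0r subr0.
Qed.

Lemma linform_dvd b f : linform b -> ~ (forall v, b v = 0) -> polyfun f ->
  (forall v, b v = 0 -> f v = 0) -> exists2 g, polyfun g & forall v, f v = b v * g v.
Proof.
move=> lb nb pf f0; have [pi [e [piE bpi _]]] := linform_proj lb nb.
have [g pg gE] := @polyfun_sub_comp_dvd f idfun pi b e pf piE.
by exists g => // v; rewrite -gE /= (f0 (pi v)) ?bpi // subr0.
Qed.

(** Composing with a projection onto the kernel of [b] turns vanishing on this hyperplane into
    vanishing everywhere. *)
Lemma linform_prime b f g : linform b -> ~ (forall v, b v = 0) -> polyfun f -> polyfun g ->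
  (forall v, b v = 0 -> f v * g v = 0) ->
  (forall v, b v = 0 -> f v = 0) \/ (forall v, b v = 0 -> g v = 0).
Proof.
move=> lb nb pf pg fg0; have [pi [e [piE bpi pi_id]]] := linform_proj lb nb.
case: (polyfun_mul_eq0 (polyfun_comp pi pf) (polyfun_comp pi pg)).
- by move=> v; rewrite fg0.
- by move=> f0; left => v /pi_id <-.
- by move=> g0; right => v /pi_id <-.
Qed.

(** * Homogeneous components *)

Definition hcomp k (f : V -> K) v := (line f 0 v)`_k.

Definition homog k (f : V -> K) := polyfun f /\ forall t v, f (t *: v) = t ^+ k * f v.

Lemma polyfun_hcomp k f : polyfun f -> polyfun (hcomp k f).
Proof.
move=> pf; elim: pf k => [c|l ll|f1 g1 p1 IH1 q1 IH2|f1 g1 p1 IH1 q1 IH2] k.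
- apply: polyfun_ext (polyfun_cst (c%:P : {poly K})`_k) _ => v.
  by rewrite /hcomp (@line_uniq _ 0 v c%:P) // => t; rewrite hornerC.
- apply: polyfun_ext (polyfun_scale ('X : {poly K})`_k (polyfun_lin ll)) _ => v.
  rewrite /hcomp (@line_uniq _ 0 v (l v *: 'X)) ?coefZ 1?mulrC // => t.
  by rewrite !hornerE linformZ // mulrC.
- apply: polyfun_ext (polyfun_add (IH1 k) (IH2 k)) _ => v.
  rewrite /hcomp -coefD [in RHS](@line_uniq _ 0 v (line f1 0 v + line g1 0 v)) // => t.
  by rewrite hornerD !lineE.
- apply: polyfun_ext (_ : polyfun (fun v => \sum_(i < k.+1) hcomp i f1 v * hcomp (k - i) g1 v)) _.
    by apply: polyfun_sum => i _; exact: polyfun_mul.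
  by move=> v; rewrite /hcomp line_mul // coefM.
Qed.

Lemma homog_hcomp k f : polyfun f -> homog k (hcomp k f).
Proof.
move=> pf; split=> [|t v]; first exact: polyfun_hcomp.
set p := line f 0 v.
rewrite /hcomp (@line_uniq _ _ _ (\poly_(i < size p) (t ^+ i * p`_i))).
  by rewrite coef_poly; case: ltnP => // ?; rewrite -/p nth_default // mulr0.
move=> s; rewrite scalerA -lineE // -/p.
rewrite horner_poly horner_coef; apply: eq_bigr => i _.
by rewrite exprMn; ring.
Qed.

Lemma hcomp_eq0 f v : polyfun f -> (forall k, hcomp k f v = 0) -> f v = 0.
Proof.
move=> pf f0; rewrite -[v]scale1r -[_ *: v]add0r -lineE //.
suff -> : line f 0 v = 0 by rewrite horner0.
by apply/polyP => k; rewrite coef0 -[LHS]/(hcomp k f v) f0.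
Qed.

Lemma hcomp0 f v : polyfun f -> hcomp 0 f v = f 0.
Proof. exact: line_coef0. Qed.

Lemma line_homog k g v : homog k g -> line g 0 v = g v *: 'X^k.
Proof. by move=> [pg hg]; apply: line_uniq => t; rewrite add0r hg !hornerE mulrC. Qed.

Lemma hcomp_mul_homog d e a g v : polyfun a -> homog e g ->
  hcomp d (fun v => a v * g v) v =
  (if (e <= d)%N then hcomp (d - e) a v else 0) * g v.
Proof.
move=> pa hg; have [pg _] := hg.
rewrite /hcomp line_mul // (line_homog _ hg) -scalerAr coefZ coefMXn mulrC ltnNge.
by case: leqP.
Qed.

Lemma hcomp_homog k g v : homog k g -> hcomp k g v = g v.
Proof. by move=> hg; rewrite /hcomp (line_homog _ hg) coefZ coefXn eqxx mulr1. Qed.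

Lemma hcomp_sum (I : Type) (r : seq I) (P : pred I) (F : I -> V -> K) k v :
  (forall i, P i -> polyfun (F i)) ->
  hcomp k (fun v => \sum_(i <- r | P i) F i v) v = \sum_(i <- r | P i) hcomp k (F i) v.
Proof. by move=> pF; rewrite /hcomp line_sum // coef_sum. Qed.

Lemma hcomp_comp (phi : {linear V -> V}) k f v :
  polyfun f -> hcomp k f (phi v) = hcomp k (fun v => f (phi v)) v.
Proof.
move=> pf; rewrite /hcomp (@line_uniq f 0 (phi v) (line (fun v => f (phi v)) 0 v)) //.
by move=> t; rewrite lineE ?linearD ?linear0 ?linearZ //; exact: polyfun_comp.
Qed.

Lemma homog_at0 k f : (0 < k)%N -> homog k f -> f 0 = 0.
Proof. by move=> k0 [_ /(_ 0 0)]; rewrite scaler0 expr0n gtn_eqF // mul0r. Qed.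

Lemma homog_add k f g : homog k f -> homog k g -> homog k (fun v => f v + g v).
Proof.
move=> [pf hf] [pg hg]; split=> [|t v]; first exact: polyfun_add.
by rewrite hf hg mulrDr.
Qed.

Lemma homog_mul k m f g : homog k f -> homog m g -> homog (k + m) (fun v => f v * g v).
Proof.
move=> [pf hf] [pg hg]; split=> [|t v]; first exact: polyfun_mul.
by rewrite hf hg exprD; ring.
Qed.

Lemma homog_lin l : linform l -> homog 1 l.
Proof. by move=> ll; split=> [|t v]; [exact: polyfun_lin|rewrite linformZ]. Qed.

Lemma homog_cst c : homog 0 (fun=> c).
Proof. by split=> [|t v]; [exact: polyfun_cst|rewrite mul1r]. Qed.

Lemma homog_comp k f (phi : {linear V -> V}) : homog k f -> homog k (fun v => f (phi v)).
Proof. by move=> [pf hf]; split=> [|t v]; [exact: polyfun_comp|rewrite linearZ hf]. Qed.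

Lemma homog_dvd k b f g : linform b -> ~ (forall v, b v = 0) -> homog k.+1 f ->
  polyfun g -> (forall v, f v = b v * g v) -> homog k g.
Proof.
move=> lb nb [pf hf] pg fE; split=> // t v.
have bgt w s : s != 0 -> b w * g (s *: w) = b w * (s ^+ k * g w).
  move=> s0; apply: (mulfI s0).
  have := fE (s *: w); rewrite hf fE (linformZ _ _ lb) exprS => E.
  by rewrite [LHS]mulrA -E; ring.
have [-> | t0] := eqVneq t 0; last first.
  have pgt : polyfun (fun v => g (t *: v)) by exact: (@polyfun_comp g (GRing.scale t)).
  apply: (polyfun_cancel (polyfun_lin lb) pgt (polyfun_scale (t ^+ k) pg) nb) => w /=.
  exact: bgt.
(* At [t = 0] the factor [b (t *: v)] vanishes and cannot be cancelled. Instead the identity is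
   proved between polynomials in the scalar, then evaluated at 0. *)
have pw w : line (fun v => b w * g v) 0 w = (b w * g w) *: 'X^k.
  apply: (@mulIf _ 'X); first by rewrite polyX_eq0.
  apply: poly_fun_inj => s; rewrite !hornerM hornerX !lineE ?add0r; last exact: polyfun_scale.
  have [->|s0] := eqVneq s 0; first by rewrite !mulr0.
  by rewrite !hornerE (bgt _ _ s0); ring.
have : forall w, b w * g 0 = b w * (0 ^+ k * g w).
  move=> w; have := congr1 (fun p => p.[0]) (pw w).
  rewrite lineE ?scale0r ?addr0; last exact: polyfun_scale.
  by move=> ->; rewrite hornerZ hornerXn; ring.
rewrite scale0r => E; exact: (polyfun_cancel (polyfun_lin lb) (polyfun_cst (g 0))
  (polyfun_scale (0 ^+ k) pg) nb E).
Qed.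

End PolynomialFunctions.
Arguments polyfun_cst {K V} c.

(** * Invariants of a finite linear group *)

Section FiniteLinearGroups.
Variables (K : numFieldType) (V : vectType K).
Implicit Types (f l : V -> K) (v : V) (g h w : 'End(V)) (G Q : seq 'End(V)).

Definition group_seq G :=
  [/\ uniq G, \1%VF \in G,
      forall g h, g \in G -> h \in G -> (g \o h)%VF \in G
    & forall g, g \in G ->
        exists2 h, h \in G & (g \o h)%VF = \1%VF /\ (h \o g)%VF = \1%VF].

Lemma big_group_mulr (R : Type) (idx : R) (op : Monoid.com_law idx) G h
    (P : pred 'End(V)) (F : 'End(V) -> R) : group_seq G -> h \in G ->
  \big[op/idx]_(g <- G | P (g \o h)%VF) F (g \o h)%VF =
  \big[op/idx]_(g <- G | P g) F g.
Proof.
move=> [uG _ mG iG] hG; have [k kG [hk kh]] := iG h hG.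
have mulK g : ((g \o h) \o k)%VF = g by rewrite -comp_lfunA hk comp_lfun1r.
have mulVK g : ((g \o k) \o h)%VF = g by rewrite -comp_lfunA kh comp_lfun1r.
rewrite -(big_map (fun g => (g \o h)%VF) P F); apply: perm_big; apply: uniq_perm => //.
  by rewrite map_inj_uniq // => g1 g2 /(congr1 (fun g => (g \o k)%VF)); rewrite !mulK.
move=> g; apply/mapP/idP => [[g' g'G ->]|gG]; first exact: mG.
by exists (g \o k)%VF; [exact: mG|rewrite mulVK].
Qed.

Variable G : seq 'End(V).
Hypothesis gG : group_seq G.

Definition invariant (f : V -> K) := forall g, g \in G -> forall v, f (g v) = f v.

Definition invpoly f := polyfun f /\ invariant f.

Lemma invpoly_cst c : invpoly (fun=> c).
Proof. by split=> //; exact: polyfun_cst. Qed.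

Lemma invpoly_add (f g : V -> K) : invpoly f -> invpoly g -> invpoly (fun v => f v + g v).
Proof. by move=> [pf sf] [pg sg]; split=> [|w wG v]; [exact: polyfun_add|rewrite sf ?sg]. Qed.

Lemma invpoly_mul (f g : V -> K) : invpoly f -> invpoly g -> invpoly (fun v => f v * g v).
Proof. by move=> [pf sf] [pg sg]; split=> [|w wG v]; [exact: polyfun_mul|rewrite sf ?sg]. Qed.

Lemma invpoly_opp f : invpoly f -> invpoly (fun v => - f v).
Proof. by move=> [pf sf]; split=> [|w wG v]; [exact: polyfun_opp|rewrite sf]. Qed.

Lemma invpoly_sum (I : Type) (r : seq I) (P : pred I) (F : I -> V -> K) :
  (forall i, P i -> invpoly (F i)) -> invpoly (fun v => \sum_(i <- r | P i) F i v).
Proof.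
move=> pF; split=> [|w wG v]; first by apply: polyfun_sum => i /pF[].
by apply: eq_bigr => i /pF[_ sF]; rewrite sF.
Qed.

Lemma invpoly_hcomp k f : invpoly f -> invpoly (hcomp k f).
Proof.
move=> [pf sf]; split=> [|w wG v]; first exact: polyfun_hcomp.
by rewrite hcomp_comp //; congr (hcomp k _ v); apply: funext => x; rewrite sf.
Qed.

Definition average (f : V -> K) v := (size G)%:R^-1 * \sum_(g <- G) f (g v).

Lemma size_group_neq0 : (size G)%:R != 0 :> K.
Proof. by case: gG => _ + _ _; rewrite pnatr_eq0; case: (G). Qed.

Lemma sum_invariant f : invariant (fun v => \sum_(g <- G) f (g v)).
Proof.
move=> w wG v; rewrite -[RHS](@big_group_mulr _ _ _ G w xpredT _ gG wG).
by apply: eq_bigr => g _; rewrite comp_lfunE.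
Qed.

Lemma invpoly_average f : polyfun f -> invpoly (average f).
Proof.
move=> pf; split=> [|w wG v]; last by rewrite /average (sum_invariant f wG).
by apply: polyfun_scale; apply: polyfun_sum => g _; exact: polyfun_comp.
Qed.

Lemma average_invariant f v : (forall g, g \in G -> f (g v) = f v) -> average f v = f v.
Proof.
move=> sf; rewrite /average big_seq (eq_bigr (fun=> f v)) => [|g gG']; last exact: sf.
rewrite -big_seq big_const_seq count_predT iter_addr_0 -(mulr_natl (f v)) mulrA.
by rewrite mulVf ?mul1r // size_group_neq0.
Qed.

Lemma polyfun_coef_prod (I : Type) (r : seq I) (P : pred I) (F : I -> V -> {poly K}) k :
  (forall i j, polyfun (fun v => (F i v)`_j)) ->
  polyfun (fun v => (\prod_(i <- r | P i) F i v)`_k).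
Proof.
move=> pF; elim: r k => [|i r IH] k.
  by apply: polyfun_ext (polyfun_cst (1 : {poly K})`_k) _ => v; rewrite big_nil.
case Pi: (P i); last by apply: polyfun_ext (IH k) _ => v; rewrite big_cons Pi.
apply: (@polyfun_ext _ _ (fun v => \sum_(j < k.+1) (F i v)`_j *
    (\prod_(i <- r | P i) F i v)`_(k - j))).
  by apply: polyfun_sum => j _; exact: polyfun_mul.
by move=> v; rewrite big_cons Pi coefM.
Qed.

Lemma polyfun_coef_XsubC f k : polyfun f -> polyfun (fun v => ('X - (f v)%:P)`_k).
Proof.
move=> pf; apply: (@polyfun_ext _ _ (fun v => ('X : {poly K})`_k - (if k == 0%N then f v else 0))).
  by apply: polyfun_sub; [exact: polyfun_cst|case: eqP => // _; exact: polyfun_cst].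
by move=> v; rewrite coefB coefC.
Qed.

(** * Finite generation over the invariants *)

Definition spanned (I : finType) (y : I -> V -> K) f :=
  exists2 a : I -> V -> K, forall i, invpoly (a i) &
    forall v, f v = \sum_i a i v * y i v.

Section Spanned.
Variables (I : finType) (y : I -> V -> K).

Lemma spanned_ext (f g : V -> K) : spanned y f -> (forall v, f v = g v) -> spanned y g.
Proof. by move=> sf /funext <-. Qed.

Lemma spanned_gen i : spanned y (y i).
Proof.
exists (fun j _ => (j == i)%:R) => [j|v]; first exact: invpoly_cst.
by rewrite (bigD1 i) //= eqxx mul1r big1 ?addr0 // => j /negPf->; rewrite mul0r.
Qed.

Lemma spanned_add (f g : V -> K) : spanned y f -> spanned y g -> spanned y (fun v => f v + g v).
Proof.
move=> [a pa aE] [b pb bE]; exists (fun i v => a i v + b i v) => [i|v].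
  exact: invpoly_add.
by rewrite aE bE -big_split; apply: eq_bigr => i _; rewrite mulrDl.
Qed.

Lemma spanned_mul a f : invpoly a -> spanned y f -> spanned y (fun v => a v * f v).
Proof.
move=> ia [b pb bE]; exists (fun i v => a v * b i v) => [i|v].
  exact: invpoly_mul.
by rewrite bE mulr_sumr; apply: eq_bigr => i _; rewrite mulrA.
Qed.

Lemma spanned0 : spanned y (fun=> 0).
Proof.
exists (fun _ _ => 0) => [i|v]; first exact: invpoly_cst.
by rewrite big1 // => i _; rewrite mul0r.
Qed.

Lemma spanned_sum (J : Type) (r : seq J) (P : pred J) (F : J -> V -> K) :
  (forall j, P j -> spanned y (F j)) -> spanned y (fun v => \sum_(j <- r | P j) F j v).
Proof.
move=> sF; elim: r => [|j r IH].
  by apply: spanned_ext spanned0 _ => v; rewrite big_nil.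
case Pj: (P j); last by apply: spanned_ext IH _ => v; rewrite big_cons Pj.
by apply: spanned_ext (spanned_add (sF _ Pj) IH) _ => v; rewrite big_cons Pj.
Qed.

Lemma spanned_closed f : (forall i, spanned y (fun v => f v * y i v)) ->
  forall g : V -> K, spanned y g -> spanned y (fun v => f v * g v).
Proof.
move=> fy g [a pa aE].
apply: spanned_ext (_ : spanned y (fun v => \sum_i a i v * (f v * y i v))) _.
  by apply: spanned_sum => i _; exact: spanned_mul.
by move=> v; rewrite aE mulr_sumr; apply: eq_bigr => i _; rewrite mulrCA.
Qed.

End Spanned.

Lemma spanned_trans (I J : finType) (y : I -> V -> K) (z : J -> V -> K) :
  (forall i, spanned z (y i)) -> forall f, spanned y f -> spanned z f.
Proof.
move=> yz f [a pa /funext ->]; apply: spanned_sum => i _; exact: spanned_mul.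
Qed.

(** [l] is a root of the monic polynomial whose roots are its conjugates under [G], and whose
    coefficients are therefore invariant. *)
Lemma linform_integral l : linform l ->
  exists2 c : nat -> V -> K, forall j, invpoly (c j) &
    forall v, l v ^+ size G = \sum_(j < size G) c j v * l v ^+ j.
Proof.
move=> ll; pose chi v : {poly K} := \prod_(g <- G) ('X - (l (g v))%:P).
exists (fun j v => - (chi v)`_j) => [j|v].
  apply: invpoly_opp; split=> [|w wG v].
    apply: polyfun_coef_prod => g k; apply: polyfun_coef_XsubC.
    by apply: polyfun_comp; exact: polyfun_lin.
  suff -> : chi (w v) = chi v by [].
  rewrite /chi -[RHS](@big_group_mulr _ _ _ G w xpredT _ gG wG).
  by apply: eq_bigr => g _; rewrite comp_lfunE.
have sz : size (chi v) = (size G).+1 by rewrite size_prod_XsubC.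
have : (chi v).[l v] = 0.
  case: gG => _ G1 _ _; rewrite /chi (big_rem _ G1) /= id_lfunE.
  by rewrite hornerM hornerXsubC subrr mul0r.
rewrite horner_coef sz big_ord_recr /=.
have -> : (chi v)`_(size G) = 1.
  by have /monicP := monic_prod_XsubC G xpredT (fun g => l (g v)); rewrite lead_coefE -/(chi v) sz.
rewrite mul1r => /eqP; rewrite addrC addr_eq0 => /eqP ->.
by rewrite -sumrN; apply: eq_bigr => j _; rewrite mulNr.
Qed.

(** The forms are adjoined one at a time, the old generators being multiplied by the powers of [l]
    below [size G]. *)
Lemma spanned_linforms (ls : seq (V -> K)) : (forall l, List.In l ls -> linform l) ->
  exists (I : finType) (y : I -> V -> K) (deg : I -> nat),
    [/\ forall i, homog (deg i) (y i), spanned y (fun=> 1) &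
      forall l, List.In l ls -> forall f, spanned y f -> spanned y (fun v => l v * f v)].
Proof.
elim: ls => [_|l ls IH lin].
  exists unit, (fun _ _ => 1), (fun=> 0%N); split=> //; first by move=> _; exact: homog_cst.
  exact: (spanned_gen _ tt).
have [I [y [deg [hy y1 yl]]]] := IH (fun l lls => lin l (or_intror lls)).
have ll := lin l (or_introl erefl).
have [c pc cE] := linform_integral ll.
have m0 : (0 < size G)%N by case: gG => _ + _ _; case: (G).
pose z (p : I * 'I_(size G)) v := y p.1 v * l v ^+ p.2.
have hl k : homog k (fun v => l v ^+ k).
  elim: k => [|k IHk]; first exact: homog_cst.
  have := homog_mul (homog_lin ll) IHk; rewrite add1n.
  by congr homog; apply: funext => v; rewrite exprS.
have zs f k : (k < size G)%N -> spanned y f -> spanned z (fun v => f v * l v ^+ k).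
  move=> km [a pa aE].
  apply: spanned_ext (_ : spanned z (fun v => \sum_i a i v * z (i, Ordinal km) v)) _.
    by apply: spanned_sum => i _; apply: spanned_mul => //; exact: spanned_gen.
  by move=> v; rewrite aE mulr_suml; apply: eq_bigr => i _; rewrite mulrA.
exists (I * 'I_(size G))%type, z, (fun p : I * 'I_(size G) => (deg p.1 + p.2)%N); split.
- by move=> [i j]; exact: homog_mul.
- by apply: spanned_ext (zs _ 0%N m0 y1) _ => v; rewrite mulr1.
move=> l' l'ls; apply: spanned_closed => -[i j].
case: l'ls => [<-|l'ls]; last first.
  apply: spanned_ext (zs _ j (ltn_ord j) (yl _ l'ls _ (spanned_gen y i))) _ => v.
  by rewrite mulrA.
have [jm|] := ltnP j.+1 (size G).
  by apply: spanned_ext (zs _ _ jm (spanned_gen y i)) _ => v; rewrite /z exprS /=; ring.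
(* The exponent reaches [size G]: the integral equation of [l] brings it back below. *)
rewrite leq_eqVlt ltnNge ltn_ord orbF => /eqP jm.
apply: spanned_ext (_ : spanned z (fun v => \sum_(k < size G) c k v * (y i v * l v ^+ k))) _.
  by apply: spanned_sum => k _; apply: spanned_mul => //; apply: zs => //; exact: spanned_gen.
move=> v; rewrite /z /= mulrCA -exprS -jm cE mulr_sumr.
by apply: eq_bigr => k _; ring.
Qed.

Lemma spanned_polyfun (I : finType) (y : I -> V -> K) : spanned y (fun=> 1) ->
  (forall i f, spanned y f -> spanned y (fun v => coord (vbasis {:V}) i v * f v)) ->
  forall f, polyfun f -> spanned y f.
Proof.
(* Generalized to products with any spanned [g], so that the induction on [f] passes through
   products. *)
move=> y1 yc f pf; suff H (g : V -> K) : spanned y g -> spanned y (fun v => f v * g v).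
  by apply: spanned_ext (H _ y1) _ => v; rewrite mulr1.
elim: pf g => [c|l ll|f1 f2 _ IH1 _ IH2|f1 f2 _ IH1 _ IH2] g yg.
- by apply: spanned_mul => //; exact: invpoly_cst.
- have H : spanned y (fun v => \sum_(i < \dim {:V}) l (vbasis {:V})`_i *
      (coord (vbasis {:V}) i v * g v)).
    apply: spanned_sum => i _; apply: spanned_mul; first exact: invpoly_cst.
    exact: yc.
  apply: spanned_ext H _.
  move=> v; rewrite [X in l X](coord_vbasis (memvf v)).
  have -> : l (\sum_(i < \dim {:V}) coord (vbasis {:V}) i v *: (vbasis {:V})`_i) =
            \sum_(i < \dim {:V}) coord (vbasis {:V}) i v * l (vbasis {:V})`_i.
    elim/big_rec2: _ => [|i a b _ <-]; first exact: linform0.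
    by rewrite ll.
  by rewrite mulr_suml; apply: eq_bigr => i _; rewrite mulrCA mulrA.
- by apply: spanned_ext (spanned_add (IH1 _ yg) (IH2 _ yg)) _ => v; rewrite mulrDl.
- by apply: spanned_ext (IH1 _ (IH2 _ yg)) _ => v; rewrite mulrA.
Qed.

Definition homog_generators m (y : 'I_m -> V -> K) (deg : 'I_m -> nat) :=
  (forall i, homog (deg i) (y i)) /\ forall f, polyfun f -> spanned y f.

Lemma homog_generators_ex : exists m (y : 'I_m -> V -> K) deg, homog_generators y deg.
Proof.
pose n := \dim {:V}.
have [|I [y [deg [hy y1 yl]]]] := @spanned_linforms
    [seq (fun v => coord (vbasis {:V}) i v) | i <- enum 'I_n].
  by move=> l /List.in_map_iff[i [<- _]]; exact: linform_coord.
exists #|I|, (fun i => y (enum_val i)), (fun i => deg (enum_val i)); split=> [i|f pf].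
  exact: hy.
apply: spanned_trans (_ : forall i, spanned _ (y i)) _ _.
  by move=> i; rewrite -(enum_rankK i); exact: (spanned_gen (fun i => y (enum_val i))).
apply: spanned_polyfun pf => // i g yg; apply: yl => //.
apply: (List.in_map (fun i v => coord (vbasis {:V}) i v)).
by elim: (enum _) (mem_enum 'I_n i) => //= j s IH; rewrite inE => /orP[/eqP->|/IH]; [left|right].
Qed.

End FiniteLinearGroups.

(** * Freeness over the invariants of a reflection group *)

Section Chevalley.
Variables (K : numFieldType) (V : vectType K) (G : seq 'End(V)).
Implicit Types (f l : V -> K) (u v : V) (g h w s : 'End(V)).

(** The shape needed for the quotients [(f \o s - f) / b]. As [rho] may be 0, the identity qualifies
    when [V] is nonzero. *)
Definition pseudoreflection s := exists (b : V -> K) (rho : V),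
  [/\ linform b, ~ (forall v, b v = 0) & forall v, s v - v = b v *: rho].

(** Generation as an induction principle, the form in which Chevalley's argument uses it; the third
    premise is closure under inverses. *)
Definition generated_by_reflections := forall P : 'End(V) -> Prop,
  P \1%VF -> (forall g h, g \in G -> h \in G -> P g -> P h -> P (g \o h)%VF) ->
  (forall g h, g \in G -> h \in G -> (g \o h)%VF = \1%VF -> P g -> P h) ->
  (forall s, s \in G -> pseudoreflection s -> P s) -> forall g, g \in G -> P g.

Hypotheses (gG : group_seq G) (refG : generated_by_reflections).

Section Ideal.
Variables (m : nat) (y : 'I_m -> V -> K) (deg : 'I_m -> nat).
Hypothesis hy : homog_generators G y deg.

(* Since y spans, these are the elements of the ideal generated by the
   invariants vanishing at 0. *)
Definition in_ideal f := exists2 a : 'I_m -> V -> K,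
  forall i, invpoly G (a i) /\ a i 0 = 0 & forall v, f v = \sum_i a i v * y i v.

Lemma in_ideal_ext f1 f2 : in_ideal f1 -> (forall v, f1 v = f2 v) -> in_ideal f2.
Proof. by move=> sf /funext <-. Qed.

Lemma in_ideal0 : in_ideal (fun=> 0).
Proof.
exists (fun _ _ => 0) => [i|v]; first by split=> //; exact: invpoly_cst.
by rewrite big1 // => i _; rewrite mul0r.
Qed.

Lemma in_ideal_add f1 f2 : in_ideal f1 -> in_ideal f2 -> in_ideal (fun v => f1 v + f2 v).
Proof.
move=> [a pa aE] [b pb bE]; exists (fun i v => a i v + b i v) => [i|v].
  have [ia a0] := pa i; have [ib b0] := pb i.
  by split; [exact: invpoly_add|rewrite a0 b0 addr0].
by rewrite aE bE -big_split; apply: eq_bigr => i _; rewrite mulrDl.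
Qed.

Lemma in_ideal_sum (J : Type) (r : seq J) (P : pred J) (F : J -> V -> K) :
  (forall j, P j -> in_ideal (F j)) -> in_ideal (fun v => \sum_(j <- r | P j) F j v).
Proof.
move=> sF; elim: r => [|j r IH].
  by apply: in_ideal_ext in_ideal0 _ => v; rewrite big_nil.
case Pj: (P j); last by apply: in_ideal_ext IH _ => v; rewrite big_cons Pj.
by apply: in_ideal_ext (in_ideal_add (sF _ Pj) IH) _ => v; rewrite big_cons Pj.
Qed.

Lemma in_ideal_mull a f : invpoly G a -> a 0 = 0 -> polyfun f ->
  in_ideal (fun v => a v * f v).
Proof.
move=> ia a0 /(proj2 hy)[c pc cE]; exists (fun i v => a v * c i v) => [i|v].
  by split; [exact: invpoly_mul|rewrite a0 mul0r].
by rewrite cE mulr_sumr; apply: eq_bigr => i _; rewrite mulrA.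
Qed.

Lemma polyfun_gen i : polyfun (y i).
Proof. by have [+ _] := hy => /(_ i)[]. Qed.

Lemma in_ideal_mul f1 f2 : polyfun f1 -> in_ideal f2 -> in_ideal (fun v => f1 v * f2 v).
Proof.
move=> pf [a pa /funext ->].
apply: in_ideal_ext (_ : in_ideal (fun v => \sum_i a i v * (f1 v * y i v))) _.
  apply: in_ideal_sum => i _; have [ia a0] := pa i; apply: in_ideal_mull => //.
  by apply: polyfun_mul => //; exact: polyfun_gen.
by move=> v; rewrite mulr_sumr; apply: eq_bigr => i _; rewrite mulrCA.
Qed.

Lemma in_ideal_comp w f : w \in G -> in_ideal f -> in_ideal (fun v => f (w v)).
Proof.
move=> wG [a pa /funext ->].
apply: in_ideal_ext (_ : in_ideal (fun v => \sum_i a i v * y i (w v))) _.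
  apply: in_ideal_sum => i _; have [ia a0] := pa i; apply: in_ideal_mull => //.
  by apply: polyfun_comp; exact: polyfun_gen.
by move=> v; apply: eq_bigr => i _; have [[_ ->]] := pa i.
Qed.

Lemma in_ideal_opp f : in_ideal f -> in_ideal (fun v => - f v).
Proof.
move=> /(in_ideal_mul (polyfun_cst (-1)))/in_ideal_ext; apply=> v.
by rewrite mulN1r.
Qed.

Lemma average_sum n (a f : 'I_n -> V -> K) v : (forall i, invpoly G (a i)) ->
  average G (fun v => \sum_i a i v * f i v) v = \sum_i a i v * average G (f i) v.
Proof.
move=> ia; rewrite /average exchange_big /= mulr_sumr.
apply: eq_bigr => i _; rewrite mulrCA; congr (_ * _).
rewrite mulr_sumr big_seq [RHS]big_seq; apply: eq_bigr => g gG'.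
by have [_ ->] := ia i.
Qed.

(* Chevalley: induction on the degree of [f j], through the operators
   [f |-> (f \o s - f) / b], which commute with the invariants. *)
Lemma chevalley k n (a f : 'I_n -> V -> K) j : (forall i, invpoly G (a i)) ->
  (forall i, polyfun (f i)) -> homog k (f j) ->
  (forall v, \sum_i a i v * f i v = 0) ->
  ~ (exists2 c : 'I_n -> V -> K, forall i, invpoly G (c i) &
       forall v, a j v = \sum_(i | i != j) c i v * a i v) ->
  in_ideal (f j).
Proof.
move=> ia; elim: k f => [|k IH] f pf hf af0 na.
  (* In degree 0 [f j] is constant. If it is nonzero, averaging the relation and dividing by it
     writes [a j] through the other [a i], against [na]. *)
  have fE v : f j v = f j 0 by have [_ /(_ 0 v)] := hf; rewrite scale0r mul1r.
  have [f0|f0] := eqVneq (f j 0) 0.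
    by apply: in_ideal_ext in_ideal0 _ => v; rewrite fE f0.
  case: na; exists (fun i v => - (f j 0)^-1 * average G (f i) v) => [i|v].
    by apply: invpoly_mul; [exact: invpoly_cst|exact: invpoly_average].
  apply: (mulfI f0); rewrite mulr_sumr.
  have := average_sum f v ia; rewrite (funext af0) /average big1 // mulr0.
  rewrite (bigD1 j) //= -/(average G (f j) v) average_invariant => [|//|g _]; last first.
    by rewrite fE [RHS]fE.
  rewrite fE mulrC => /esym/eqP; rewrite addr_eq0 => /eqP ->.
  rewrite -sumrN; apply: eq_bigr => i _; rewrite -/(average G (f i) v).
  by rewrite -[X in _ = _ * X]mulrA [RHS]mulrA mulrN divff // mulN1r mulrC.
(* By generation it suffices to treat reflections, where the difference is [b] times [q j], and the
   [q i] satisfy the same relation with [q j] of lower degree. *)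
have dif w : w \in G -> in_ideal (fun v => f j (w v) - f j v).
  apply: (refG (P := fun w => in_ideal (fun v => f j (w v) - f j v))).
  - by apply: in_ideal_ext in_ideal0 _ => v; rewrite id_lfunE subrr.
  - move=> g h gG' hG ig ih.
    apply: in_ideal_ext (in_ideal_add (in_ideal_comp hG ig) ih) _ => v.
    by rewrite comp_lfunE addrA subrK.
  - move=> g h gG' hG gh1 ig.
    apply: in_ideal_ext (in_ideal_opp (in_ideal_comp hG ig)) _ => v.
    by rewrite opprB -comp_lfunE gh1 id_lfunE.
  move=> s sG [b [rho [lb nb sE]]].
  have /choice[q qP] i : exists q, polyfun q /\ forall v, f i (s v) - f i v = b v * q v.
    by have [q pq qE] := @polyfun_sub_comp_dvd _ _ (f i) s idfun b rho (pf i) sE; exists q.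
  suff : in_ideal (q j).
    by move=> /(in_ideal_mul (polyfun_lin lb))/in_ideal_ext; apply=> v; rewrite (qP j).2.
  apply: IH na => [i||]; first exact: (qP i).1.
  - apply: (homog_dvd lb nb _ (qP j).1 (qP j).2).
    have hs := homog_comp s hf.
    have := homog_add hs (homog_mul (homog_cst V (-1)) hf).
    by congr homog; apply: funext => v; rewrite mulN1r.
  - apply: (polyfun_cancel (polyfun_lin lb) _ (polyfun_cst 0) nb).
      by apply: polyfun_sum => i _; apply: polyfun_mul; [exact: (ia i).1|exact: (qP i).1].
    move=> v; rewrite mulr0 mulr_sumr.
    rewrite (eq_bigr (fun i => a i (s v) * f i (s v) - a i v * f i v)).
      by rewrite sumrB !af0 subr0.
    by move=> i _; rewrite (ia i).2 // -mulrBr (qP i).2 mulrCA.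
have [pj _] := hf.
(* [f j] is its average, an invariant vanishing at 0 since the degree is positive, minus the mean of
   the differences [f j \o w - f j]. *)
have av0 : average G (f j) 0 = 0.
  by rewrite average_invariant => [|//|g _]; rewrite ?linear0 (homog_at0 _ hf).
have i1 : in_ideal (average G (f j)).
  have := in_ideal_mull (invpoly_average gG pj) av0 (polyfun_cst 1).
  by move/in_ideal_ext; apply=> v; rewrite mulr1.
have i2 : in_ideal (fun v => - (size G)%:R^-1 * \sum_(w <- G | w \in G) (f j (w v) - f j v)).
  by apply: in_ideal_mul (polyfun_cst _) _; apply: in_ideal_sum => w /dif.
apply: in_ideal_ext (in_ideal_add i1 i2) _ => v.
rewrite -big_seq sumrB big_const_seq count_predT iter_addr_0.
rewrite /average mulNr mulrBr -(mulr_natl (f j v)) mulrA mulVf ?(size_group_neq0 gG) //.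
by rewrite mul1r opprB addrC subrK.
Qed.

End Ideal.

Definition minimal_generators m (y : 'I_m -> V -> K) deg :=
  homog_generators G y deg /\
  forall m' (y' : 'I_m' -> V -> K) deg', homog_generators G y' deg' -> (m <= m')%N.

Lemma minimal_generators_ex : exists m (y : 'I_m -> V -> K) deg, minimal_generators y deg.
Proof.
have [m0 [y0 [deg0 h0]]] := homog_generators_ex gG.
pose P m := `[< exists (y : 'I_m -> V -> K) deg, homog_generators G y deg >].
have exP : exists m, P m by exists m0; apply/asboolP; exists y0, deg0.
have [m /asboolP[y [deg hy]] mmin] := ex_minnP exP.
exists m, y, deg; split=> // m' y' deg' h'.
by apply: mmin; apply/asboolP; exists y', deg'.
Qed.

(** Graded Nakayama: in the component of degree [deg j] of such an expression, [y j] has the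
    constant coefficient [a j 0 = 0], so [y j] is a combination of the other generators and could be
    dropped. *)
Lemma minimal_notin_ideal m (y : 'I_m -> V -> K) deg j :
  minimal_generators y deg -> ~ in_ideal y (y j).
Proof.
case: m y deg j => [|m] y deg j [hy ymin] [a pa aE]; first by have := ltn_ord j.
suff /ymin : homog_generators G (fun i => y (lift j i)) (fun i => deg (lift j i)).
  by rewrite ltnn.
have [hom spn] := hy; split=> [i|f /spn]; first exact: hom.
apply: spanned_trans => // i; have [ij|ij] := eqVneq i j; last first.
  have [i' ->] : exists i', i = lift j i' by case: (unliftP j i) ij => [i' ->|->]; [exists i'|rewrite eqxx].
  exact: (spanned_gen G (fun i => y (lift j i))).
rewrite {i}ij.
pose e i := if (deg i <= deg j)%N then hcomp (deg j - deg i) (a i) else fun=> 0.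
have ie i : invpoly G (e i).
  by rewrite /e; case: ifP => _; [apply: invpoly_hcomp; case: (pa i)|exact: invpoly_cst].
have yE v : y j v = \sum_i e i v * y i v.
  rewrite -(hcomp_homog v (hom j)) [X in hcomp _ X](funext aE) hcomp_sum => [|i _].
    apply: eq_bigr => i _; rewrite (hcomp_mul_homog _ _ _ (hom i)); last by case: (pa i) => [[]].
    by rewrite /e; case: ifP.
  by apply: polyfun_mul; [by case: (pa i) => [[]]|by case: (hom i)].
exists (fun i => e (lift j i)) => [i|v]; first exact: ie.
rewrite yE (bigD1_ord j) //= /e leqnn subnn hcomp0; last by case: (pa j) => [[]].
by rewrite (pa j).2 mul0r add0r.
Qed.

(** Induction on the number of nonzero coefficients. If [a j] is nonzero, [chevalley] and
    [minimal_notin_ideal] write it through the other [a i], and a change of generators removes it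
    from the relation. [N] is the common degree of the terms. *)
Lemma minimal_free_homog N m (y : 'I_m -> V -> K) deg (a : 'I_m -> V -> K) :
  minimal_generators y deg -> (forall i, invpoly G (a i)) ->
  (forall i, (exists v, a i v != 0) -> (deg i <= N)%N /\ homog (N - deg i) (a i)) ->
  (forall v, \sum_i a i v * y i v = 0) -> forall i v, a i v = 0.
Proof.
have [c] := ubnP #|[pred i | `[< exists v, a i v != 0 >]]|.
elim: c y a => // c IH y a; rewrite ltnS => ca my ia ha ay0.
suff na j : ~ exists v, a j v != 0.
  by move=> i v; apply/eqP/negPn/negP => nv; apply: (na i); exists v.
move=> aj0; have [dj hj] := ha j aj0; have [hy ymin] := my; have [hom spn] := hy.
have [[c0 ic cE]|nc] := pselect (exists2 c : 'I_m -> V -> K, forall i, invpoly G (c i) &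
       forall v, a j v = \sum_(i | i != j) c i v * a i v); last first.
  apply: (minimal_notin_ideal (j := j) my).
  by apply: (chevalley hy ia (fun i => polyfun_gen hy i) (hom j)).
(* Only the component of [c0 i] of degree [deg i - deg j] contributes, and keeping just this one
   makes the new generators homogeneous. The guard [deg j <= deg i] is against truncated
   subtraction. *)
pose e i := if `[< exists v, a i v != 0 >] && (deg j <= deg i)%N
            then hcomp (deg i - deg j) (c0 i) else fun=> 0.
have ie i : invpoly G (e i).
  by rewrite /e; case: ifP => _; [exact: invpoly_hcomp|exact: invpoly_cst].
have aE v : a j v = \sum_(i | i != j) e i v * a i v.
  rewrite -(hcomp_homog v hj) [X in hcomp _ X](funext cE) hcomp_sum => [|i _]; last first.
    by apply: polyfun_mul; [case: (ic i)|case: (ia i)].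
  apply: eq_bigr => i _; rewrite /e; case: asboolP => [/ha[di hi]|ai0] /=.
    rewrite (hcomp_mul_homog _ _ _ hi); last by case: (ic i).
    have -> : (N - deg j - (N - deg i) = deg i - deg j)%N.
      by rewrite subnBA // addnC addnBA // subnAC addnK.
    by rewrite leq_sub2lE //; case: ifP.
  have {}ai0 : a i = fun=> 0.
    by apply: funext => x; apply/eqP/negPn/negP => nx; apply: ai0; exists x.
  rewrite ai0 mul0r /hcomp (@line_uniq _ _ _ 0 v 0) ?coef0 // => t.
  by rewrite mulr0 horner0.
(* Substituting for [a j], the relation becomes [\sum_(i | i != j) a i * (y i + e i * y j) = 0],
   with one nonzero coefficient fewer. *)
pose y' i : V -> K := if i == j then y j else fun v => y i v + e i v * y j v.
pose a' i : V -> K := if i == j then fun=> 0 else a i.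
have my' : minimal_generators y' deg.
  split=> //; split=> [i|f /spn].
    rewrite /y'; case: eqP => [->|_]; first exact: hom.
    apply: homog_add; first exact: hom.
    rewrite /e; case: ifP => [/andP[_ dij]|_].
      have := homog_mul (homog_hcomp (deg i - deg j) (proj1 (ic i))) (hom j).
      by rewrite subnK.
    split=> [|t v]; last by rewrite !mul0r mulr0.
    by apply: polyfun_mul; [exact: polyfun_cst|case: (hom j)].
  apply: spanned_trans => // i; have y'j : y' j = y j by rewrite /y' eqxx.
  have [->|ij] := eqVneq i j; first by rewrite -y'j; exact: spanned_gen.
  have := spanned_add (spanned_gen G y' i)
    (spanned_mul (invpoly_opp (ie i)) (spanned_gen G y' j)).
  move/spanned_ext; apply=> v; rewrite y'j /y' (negPf ij); ring.
have a'0 : forall i v, a' i v = 0.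
  apply: (IH y') => //.
  - apply: leq_trans ca; apply: proper_card; apply/properP; split.
      apply/fintype.subsetP => i /(@asboolP (exists v, a' i v != 0))[v] nz.
      apply/(@asboolP (exists v, a i v != 0)); exists v; move: nz; rewrite /a'.
      by case: (eqVneq i j) => [_ /=|//]; rewrite eqxx.
    exists j; first exact/(@asboolP (exists v, a j v != 0)).
    by apply/negP => /(@asboolP (exists v, a' j v != 0))[v]; rewrite /a' eqxx eqxx.
  - by move=> i; rewrite /a'; case: ifP => _; [exact: invpoly_cst|].
  - by move=> i; rewrite /a'; case: ifP => _; [move=> [v]; rewrite eqxx|exact: ha].
  move=> v; rewrite -[RHS](ay0 v) [RHS](bigD1 j) //= (bigD1 j) //= {1}/a' eqxx mul0r add0r.
  rewrite aE mulr_suml -big_split; apply: eq_bigr => i ij.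
  by rewrite /a' /y' (negPf ij) /=; ring.
have [v] := aj0; rewrite aE big1 ?eqxx // => i ij.
by have := a'0 i v; rewrite /a' (negPf ij) => ->; rewrite mulr0.
Qed.

(** The component of the relation in degree [deg i + k] involves the component of degree [k] of
    [a i]. *)
Lemma minimal_free m (y : 'I_m -> V -> K) deg (a : 'I_m -> V -> K) :
  minimal_generators y deg -> (forall i, invpoly G (a i)) ->
  (forall v, \sum_i a i v * y i v = 0) -> forall i v, a i v = 0.
Proof.
move=> my ia ay0 i v; have [[hom _] _] := my.
apply: hcomp_eq0 => [|k]; first by case: (ia i).
pose N := (deg i + k)%N.
pose b i v := if (deg i <= N)%N then hcomp (N - deg i) (a i) v else 0.
have -> : hcomp k (a i) v = b i v by rewrite /b /N leq_addr addKn.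
apply: (minimal_free_homog (N := N) my) => [j|j|x].
- by rewrite /b; case: leqP => _; [exact: invpoly_hcomp|exact: invpoly_cst].
- rewrite /b; case: leqP => _; last by move=> [x]; rewrite eqxx.
  by move=> _; split=> //; apply: homog_hcomp; case: (ia j).
have : hcomp N (fun v => \sum_j a j v * y j v) x = 0.
  by rewrite (funext ay0) /hcomp (@line_uniq _ _ _ 0 x 0) ?coef0 // => t; rewrite horner0.
rewrite hcomp_sum => [E|j _]; last first.
  by apply: polyfun_mul; [case: (ia j)|case: (hom j)].
rewrite -[RHS]E; apply: eq_bigr => j _; rewrite (hcomp_mul_homog _ _ _ (hom j)).
  by rewrite /b; case: ifP.
by case: (ia j).
Qed.

(** By freeness the coordinates [c f i] in the basis [y] are unique, hence linear over the
    invariants; [T] sends each [y i] to the constant [D (y i)]. *)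
Lemma lift_functional u (D : (V -> K) -> K) :
  (forall f1 f2, polyfun f1 -> polyfun f2 -> D (fun v => f1 v + f2 v) = D f1 + D f2) ->
  (forall a f, invpoly G a -> polyfun f -> D (fun v => a v * f v) = a u * D f) ->
  exists T : (V -> K) -> (V -> K), [/\ forall f, polyfun f -> invpoly G (T f),
    forall f1 f2, polyfun f1 -> polyfun f2 ->
      forall v, T (fun v => f1 v + f2 v) v = T f1 v + T f2 v,
    forall a f, invpoly G a -> polyfun f ->
      forall v, T (fun v => a v * f v) v = a v * T f v
  & forall f, polyfun f -> T f u = D f].
Proof.
move=> DD DM; have [m [y [deg my]]] := minimal_generators_ex.
have [[hom spn] _] := my.
have /choice[c cP] f : exists c : 'I_m -> V -> K, polyfun f ->
    (forall i, invpoly G (c i)) /\ forall v, f v = \sum_i c i v * y i v.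
  have [/spn[c ic cE]|nf] := pselect (polyfun f); first by exists c.
  by exists (fun _ _ => 0) => /nf.
have uniq f (b : 'I_m -> V -> K) : polyfun f -> (forall i, invpoly G (b i)) ->
    (forall v, f v = \sum_i b i v * y i v) -> forall i v, c f i v = b i v.
  move=> pf ib bE i v; have [ic cE] := cP f pf; apply/eqP; rewrite -subr_eq0; apply/eqP.
  apply: (minimal_free my (a := fun i v => c f i v - b i v)) => [j|x].
    by apply: invpoly_add => //; exact: invpoly_opp.
  rewrite (eq_bigr (fun j => c f j x * y j x - b j x * y j x)) => [|j _]; last by rewrite mulrBl.
  by rewrite sumrB -cE -bE subrr.
exists (fun f v => \sum_i c f i v * D (y i)); split.
- move=> f pf; apply: invpoly_sum => i _; apply: invpoly_mul; last exact: invpoly_cst.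
  exact: (cP f pf).1.
- move=> f1 f2 p1 p2 v; have [i1 E1] := cP _ p1; have [i2 E2] := cP _ p2.
  rewrite -big_split; apply: eq_bigr => i _ /=.
  rewrite (uniq _ (fun i v => c f1 i v + c f2 i v)) ?mulrDl //.
  + exact: polyfun_add.
  + by move=> j; exact: invpoly_add.
  + by move=> x; rewrite E1 E2 -big_split; apply: eq_bigr => j _; rewrite mulrDl.
- move=> a f ia pf v; have [ic cE] := cP _ pf.
  rewrite mulr_sumr; apply: eq_bigr => i _.
  rewrite (uniq _ (fun i v => a v * c f i v)) ?mulrA //.
  + by apply: polyfun_mul => //; case: ia.
  + by move=> j; exact: invpoly_mul.
  + by move=> x; rewrite cE mulr_sumr; apply: eq_bigr => j _; rewrite mulrA.
move=> f pf; have [ic cE] := cP _ pf.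
have -> : D f = D (fun v => \sum_i c f i v * y i v) by congr D; exact: funext.
elim: (index_enum _) => [|i r IH].
  have -> : (fun v => \sum_(i <- [::]) c f i v * y i v) = (fun v => 0 * (0 : K)).
    by apply: funext => v; rewrite big_nil mulr0.
  rewrite big_nil (DM (fun=> 0)) ?mul0r //; [exact: invpoly_cst|exact: polyfun_cst].
rewrite big_cons IH -DM //; last by case: (hom i).
rewrite -DD; first by congr D; apply: funext => v; rewrite big_cons.
  by apply: polyfun_mul; [case: (ic i)|case: (hom i)].
by apply: polyfun_sum => j _; apply: polyfun_mul; [case: (ic j)|case: (hom j)].
Qed.

End Chevalley.

(** * Trace formulas for maps linear over the invariants *)

Lemma big_group_mull (K : numFieldType) (V : vectType K) (R : Type) (idx : R)
    (op : Monoid.com_law idx) (G : seq 'End(V)) h (F : 'End(V) -> R) :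
  group_seq G -> h \in G ->
  \big[op/idx]_(g <- G) F (h \o g)%VF = \big[op/idx]_(g <- G) F g.
Proof.
move=> [uG _ mG iG] hG; have [k kG [hk kh]] := iG h hG.
have mulK g : (k \o (h \o g))%VF = g by rewrite comp_lfunA kh comp_lfun1l.
have mulVK g : (h \o (k \o g))%VF = g by rewrite comp_lfunA hk comp_lfun1l.
rewrite -(big_map (fun g => (h \o g)%VF) xpredT F); apply: perm_big; apply: uniq_perm => //.
  by rewrite map_inj_uniq // => g1 g2 /(congr1 (fun g => (k \o g)%VF)); rewrite !mulK.
move=> g; apply/mapP/idP => [[g' g'G ->]|gG]; first exact: mG.
by exists (k \o g)%VF; [exact: mG|rewrite mulVK].
Qed.

Section Lagrange.
Variables (K : numFieldType) (V : vectType K) (G Q : seq 'End(V)).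
Implicit Types (f l : V -> K) (u v : V) (g h w s q : 'End(V)).
Hypotheses (gG : group_seq G) (gQ : group_seq Q) (QG : {subset Q <= G}).

Variable T : (V -> K) -> (V -> K).
Hypotheses (T_inv : forall f, polyfun f -> invpoly G (T f))
  (TD : forall f1 f2, polyfun f1 -> polyfun f2 ->
      forall v, T (fun v => f1 v + f2 v) v = T f1 v + T f2 v)
  (TM : forall a f, invpoly G a -> polyfun f ->
      forall v, T (fun v => a v * f v) v = a v * T f v).

Lemma lin_over_invariants_sum n (c F : 'I_n -> V -> K) v :
  (forall i, invpoly G (c i)) -> (forall i, polyfun (F i)) ->
  T (fun v => \sum_i c i v * F i v) v = \sum_i c i v * T (F i) v.
Proof.
move=> ic pF; elim: (index_enum _) => [|i r IH].
  rewrite big_nil -[RHS](mul0r (T (fun=> 0) v)) -(TM (invpoly_cst G 0) (polyfun_cst 0)).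
  by congr (T _ v); apply: funext => x; rewrite big_nil mul0r.
rewrite big_cons -IH -TM // -TD.
- by congr (T _ v); apply: funext => x; rewrite big_cons.
- by apply: polyfun_mul => //; case: (ic i).
by apply: polyfun_sum => j _; apply: polyfun_mul => //; case: (ic j).
Qed.

Definition rcoset w := [seq (q \o w)%VF | q <- Q].

Lemma rcoset1 : rcoset \1%VF = Q.
Proof. by rewrite /rcoset -[RHS]map_id; apply: eq_map => q; rewrite comp_lfun1r. Qed.

Lemma rcoset_id q : q \in Q -> rcoset q =i Q.
Proof.
move=> qQ g; have [uQ Q1 mQ iQ] := gQ; have [k kQ [qk kq]] := iQ q qQ.
apply/mapP/idP => [[p pQ ->]|gQ']; first exact: mQ.
by exists (g \o k)%VF; [exact: mQ|rewrite -comp_lfunA kq comp_lfun1r].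
Qed.

Lemma rcoset_mulr w' w g : g \in G ->
  ((w' \o g)%VF \in rcoset (w \o g)) = (w' \in rcoset w).
Proof.
move=> gG'; have [uG G1 mG iG] := gG; have [k kG [gk kg]] := iG g gG'.
apply/mapP/mapP => -[q qQ E]; exists q => //; last by rewrite E comp_lfunA.
have := congr1 (fun h => (h \o k)%VF) E.
by rewrite -!comp_lfunA gk !comp_lfun1r.
Qed.

Variable theta : V -> K.
Hypothesis theta_inv : invpoly Q theta.

(** The numerator of Lagrange interpolation, with the conjugates of [theta] as nodes. *)
Definition coset_poly w v : {poly K} :=
  \prod_(w' <- G | w' \notin rcoset w) ('X - (theta (w' v))%:P).

(** Each coset of [Q] other than [Q] occurs [size Q] times: this is the [size Q]-th power of the
    derivative, at [theta], of the polynomial with one conjugate of [theta] per coset as roots. *)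
Definition different v := \prod_(w <- G | w \notin Q) (theta v - theta (w v)).

Lemma coset_poly_mulr w g v : g \in G -> coset_poly w (g v) = coset_poly (w \o g)%VF v.
Proof.
move=> gG'; rewrite /coset_poly.
rewrite -[RHS](@big_group_mulr _ _ _ _ _ G g (fun w' => w' \notin rcoset (w \o g)) _ gG gG').
by apply: eq_big => [w'|w' _]; [rewrite rcoset_mulr|rewrite comp_lfunE].
Qed.

Lemma size_coset_poly w v : (size (coset_poly w v) <= (size G).+1)%N.
Proof.
rewrite /coset_poly -big_filter size_prod_XsubC ltnS size_filter; exact: count_size.
Qed.

Lemma polyfun_coset_poly w k : polyfun (fun v => (coset_poly w v)`_k).
Proof.
apply: polyfun_coef_prod => w' j; apply: polyfun_coef_XsubC.
by apply: polyfun_comp; case: theta_inv.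
Qed.

Lemma different_inv : invpoly Q different.
Proof.
have [pt it] := theta_inv.
split=> [|q qQ v].
  by apply: polyfun_prod => w _; apply: polyfun_sub => //; exact: polyfun_comp.
rewrite /different.
rewrite -[RHS](@big_group_mulr _ _ _ _ _ G q (fun w' => w' \notin Q) _ gG (QG qQ)).
apply: eq_big => [w|w _]; last by rewrite it // comp_lfunE.
congr (~~ _); rewrite -(rcoset_id qQ (w \o q)%VF) -{2}[q]comp_lfun1l.
by rewrite rcoset_mulr ?QG // rcoset1.
Qed.

(** Unnormalized Lagrange interpolation: its coefficients are invariant under [G], and for a
    [Q]-invariant [f] its value at [theta] is [f] up to the factor [size Q] times [different]. *)
Definition interp f v : {poly K} := \sum_(w <- G) f (w v) *: coset_poly w v.

Lemma invpoly_interp f k : polyfun f -> invpoly G (fun v => (interp f v)`_k).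
Proof.
move=> pf; split=> [|g gG' v].
  apply: polyfun_ext (_ : polyfun (fun v => \sum_(w <- G) f (w v) * (coset_poly w v)`_k)) _.
    apply: polyfun_sum => w _; apply: polyfun_mul; [exact: polyfun_comp|exact: polyfun_coset_poly].
  by move=> v; rewrite coef_sum; apply: eq_bigr => w _; rewrite coefZ.
suff -> : interp f (g v) = interp f v by [].
rewrite /interp -[RHS](@big_group_mulr _ _ _ _ _ G g xpredT _ gG gG').
by apply: eq_bigr => w _; rewrite coset_poly_mulr // comp_lfunE.
Qed.

Lemma horner_interp f v : invpoly Q f ->
  (interp f v).[theta v] = (size Q)%:R * (f v * different v).
Proof.
move=> [pf iv]; rewrite /interp horner_sum.
have [uG G1 mG iG] := gG; have [uQ Q1 mQ iQ] := gQ.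
rewrite (bigID (mem Q)) /= [X in _ + X]big1_seq ?addr0 => [|w /andP[wQ wG]]; last first.
  (* For [w] outside [Q] the identity is not in the coset of [w], so ['X - theta] divides the
     term. *)
  rewrite hornerZ horner_prod (big_rem _ G1) /=.
  have -> : \1%VF \notin rcoset w.
    apply: contra wQ => /mapP[q qQ E]; have [k kQ [qk kq]] := iQ q qQ.
    suff -> : w = k by [].
    by rewrite -[LHS]comp_lfun1l -kq -comp_lfunA -E comp_lfun1r.
  by rewrite id_lfunE hornerXsubC subrr mul0r mulr0.
rewrite (eq_bigr (fun=> f v * different v)) => [|w wQ].
  rewrite -big_filter big_const_seq count_predT iter_addr_0 -(mulr_natl (f v * _)).
  congr (_%:R * _); apply: perm_size; apply: uniq_perm => //; first exact: filter_uniq.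
  by move=> w; rewrite mem_filter; apply/andP/idP => [[]//|wQ]; split=> //; exact: QG.
rewrite hornerZ horner_prod iv //; congr (_ * _); apply: eq_big => [w'|w' _].
  by rewrite rcoset_id.
by rewrite hornerXsubC.
Qed.

(** For invariant coefficients and degree at most [size G] this is [T] applied to [p.[theta]]. It is
    extended to arbitrary coefficients so as to apply to each [coset_poly] separately. *)
Definition pairing v (p : {poly K}) :=
  \sum_(k < (size G).+1) p`_k * T (fun v => theta v ^+ k) v.

Lemma polyfun_exp f k : polyfun f -> polyfun (fun v => f v ^+ k).
Proof.
move=> pf; elim: k => [|k IH]; first exact: polyfun_cst.
by apply: polyfun_ext (polyfun_mul pf IH) _ => v; rewrite exprS.
Qed.

Let pt : polyfun theta. Proof. by case: theta_inv. Qed.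

Lemma pairing_inv g v p : g \in G -> pairing (g v) p = pairing v p.
Proof.
move=> gG'; apply: eq_bigr => k _.
by have [_ ->] := T_inv (polyfun_exp k pt).
Qed.

(* Lagrange interpolation of f along the conjugates of theta. *)
Lemma lagrange_trace : exists2 r, invpoly Q r & forall f, invpoly Q f ->
  forall v, T (fun v => f v * different v) v = \sum_(w <- G) f (w v) * r (w v).
Proof.
have sQ := size_group_neq0 gQ.
pose r v := (size Q)%:R^-1 * pairing v (coset_poly \1%VF v).
have rw w v : w \in G -> r (w v) = (size Q)%:R^-1 * pairing v (coset_poly w v).
  by move=> wG; rewrite /r pairing_inv // coset_poly_mulr // comp_lfun1l.
exists r => [|f iv v]; first split.
- apply: polyfun_scale; apply: polyfun_sum => k _; apply: polyfun_mul.
    exact: polyfun_coset_poly.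
  by have [] := T_inv (polyfun_exp k pt).
- move=> q qQ v; rewrite rw ?QG // /r /coset_poly; congr (_ * pairing _ _).
  by apply: eq_bigl => w; rewrite rcoset_id // rcoset1.
have [pf _] := iv; apply: (mulfI sQ); rewrite mulr_sumr.
(* As the coefficients of [interp f] are invariant, [T] acts only on the powers of [theta], and the
   sum over [G] defining [interp] becomes the trace. *)
transitivity (T (fun v => (interp f v).[theta v]) v).
  rewrite -(TM (invpoly_cst G _)); last by apply: polyfun_mul => //; case: different_inv.
  by congr (T _ v); apply: funext => x; rewrite horner_interp.
have E : (fun v => (interp f v).[theta v]) =
         fun v => \sum_(k < (size G).+1) (interp f v)`_k * theta v ^+ k.
  apply: funext => x; apply: horner_coef_wide.
  apply: leq_trans (size_sum _ _ _) _; apply/bigmax_leqP_seq => w _ _.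
  exact: leq_trans (size_scale_leq _ _) (size_coset_poly _ _).
rewrite E (lin_over_invariants_sum v (fun k => invpoly_interp k pf)
  (fun k => polyfun_exp k pt)).
rewrite (eq_bigr (fun k : 'I__ => \sum_(w <- G) f (w v) *
    ((coset_poly w v)`_k * T (fun v => theta v ^+ k) v))) => [|k _]; last first.
  by rewrite coef_sum mulr_suml; apply: eq_bigr => w _; rewrite coefZ mulrA.
rewrite exchange_big big_seq [RHS]big_seq; apply: eq_bigr => w wG /=.
by rewrite -mulr_sumr -/(pairing v _) rw // [RHS]mulrCA mulVKf.
Qed.

End Lagrange.

(** * Stabilizers of points *)

Lemma filter_group_seq (K : numFieldType) (V : vectType K) (G : seq 'End(V))
    (P : pred 'End(V)) : group_seq G -> P \1%VF ->
  (forall g h, P g -> P h -> P (g \o h)%VF) ->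
  (forall g h, (h \o g)%VF = \1%VF -> P g -> P h) -> group_seq (filter P G).
Proof.
move=> [uG G1 mG iG] P1 mP iP; split.
- exact: filter_uniq.
- by rewrite mem_filter P1.
- move=> g h; rewrite !mem_filter => /andP[Pg gG] /andP[Ph hG].
  by rewrite mP //= mG.
move=> g; rewrite mem_filter => /andP[Pg gG]; have [h hG [gh hg]] := iG g gG.
by exists h => //; rewrite mem_filter hG andbT; exact: iP hg Pg.
Qed.

Lemma separate_point (K : numFieldType) (V : vectType K) (v : V) (r : seq V) :
  exists2 k : V -> K, polyfun k & k v = 1 /\ forall x, x \in r -> x != v -> k x = 0.
Proof.
have /choice[l lP] x : exists l : V -> K, linform l /\ (x != v -> l (v - x) = 1).
  have [->|xv] := eqVneq x v.
    by exists (fun=> 0); split=> // a y z; rewrite mulr0 addr0.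
  have [|l ll lE] := @linform_neq0 _ _ (v - x); first by rewrite subr_eq0 eq_sym.
  by exists l.
exists (fun y => \prod_(x <- r | x != v) (l x y - l x x)); last split.
- apply: polyfun_prod => x _; apply: polyfun_sub; last exact: polyfun_cst.
  by apply: polyfun_lin; case: (lP x).
- rewrite big1 // => x xv; have [ll lE] := lP x.
  by rewrite -linformB // lE.
by move=> x xr xv; rewrite (big_rem x xr) /= xv subrr mul0r.
Qed.

(** Each [w] moving some point of the image of [pi] gives a nonzero polynomial in [v]; a generic [v]
    avoids the zeros of all of these and of [n \o pi], the index [None]. *)
Lemma generic_stabilizer (K : numFieldType) (V : vectType K) (r : seq 'End(V))
    (pi : {linear V -> V}) (n : V -> K) : polyfun n -> (exists v, n (pi v) != 0) ->
  exists v, n (pi v) != 0 /\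
    forall w, w \in r -> w (pi v) = pi v -> forall z, w (pi z) = pi z.
Proof.
move=> pn [v0 nv0].
have /choice[l lP] (w : 'End(V)) : exists l : V -> K, linform l /\
    ((exists z, w (pi z) != pi z) -> exists z, l (w (pi z)) != l (pi z)).
  have [[z wz]|no] := pselect (exists z, w (pi z) != pi z).
    have [l ll lz] := linform_neq wz.
    by exists l; split=> // _; exists z.
  by exists (fun=> 0); split=> // a x y; rewrite mulr0 addr0.
pose F (o : option 'End(V)) v := if o is Some w then l w (w (pi v)) - l w (pi v) else n (pi v).
pose r' := None :: [seq Some w | w : 'End(V) <- r & `[< exists z, w (pi z) != pi z >]].
have [|o or'|v vP] := @generic_point K V _ r' F.
- move=> [w|] _ /=; last exact: polyfun_comp.
  have ll := polyfun_lin (lP w).1.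
  by apply: polyfun_sub; [apply: (polyfun_comp pi (polyfun_comp w ll))|exact: polyfun_comp].
- case: o or' => [w|_]; last by exists v0.
  rewrite inE /= => /mapP[w' + [->]]; rewrite mem_filter => /andP[/asboolP nw _].
  by have [z lz] := (lP w').2 nw; exists z; rewrite /F subr_eq0.
exists v; split; first exact: (vP None (mem_head _ _)).
move=> w wr wv z; apply/eqP/negPn/negP => nz.
have : Some w \in r'.
  rewrite inE /=; apply: map_f; rewrite mem_filter wr andbT.
  by apply/asboolP; exists z.
by move/vP; rewrite /F wv subrr eqxx.
Qed.

(** The prime [l i] divides [R * h] but not [h], hence divides [R], and can be cancelled in all the
    other relations. This goes through for repeated factors. *)
Lemma linforms_dvd (K : numFieldType) (V : vectType K) (I : eqType) (s : seq I)
    (l : I -> V -> K) (R D : V -> K) :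
  (forall i, i \in s -> linform (l i) /\ ~ (forall v, l i v = 0)) ->
  polyfun R -> polyfun D ->
  (forall i, i \in s -> exists h r, [/\ polyfun h, polyfun r,
     exists v, l i v = 0 /\ h v != 0 &
     forall v, R v * h v = \prod_(i <- s) l i v * D v * r v]) ->
  exists2 R1, polyfun R1 & forall v, R v = \prod_(i <- s) l i v * R1 v.
Proof.
elim: s R => [|i s IH] R ls pR pD div.
  by exists R => // v; rewrite big_nil mul1r.
have [li ni] := ls i (mem_head _ _).
have pl := polyfun_lin li.
have ps : polyfun (fun v => \prod_(i <- s) l i v).
  apply: polyfun_ext (_ : polyfun (fun v => \prod_(i <- s | i \in s) l i v)) _.
    by apply: polyfun_prod => j js; apply: polyfun_lin; apply: (ls j _).1; rewrite inE js orbT.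
  by move=> v; rewrite [RHS]big_seq.
have [R' pR' RE] : exists2 R', polyfun R' & forall v, R v = l i v * R' v.
  have [h [r [ph pr [v [lv hv]] E]]] := div i (mem_head _ _).
  apply: linform_dvd => //.
  have [x lx|//|h0] := linform_prime li ni pR ph.
    by rewrite E big_cons lx !mul0r.
  by move: hv; rewrite (h0 v lv) eqxx.
have [j js|//|//|j js|R1 pR1 R1E] := IH R'.
- by apply: ls; rewrite inE js orbT.
- have [|h [r [ph pr hv E]]] := div j; first by rewrite inE js orbT.
  exists h, r; split=> //.
  apply: (polyfun_cancel pl _ _ ni); [exact: polyfun_mul| |].
    by apply: polyfun_mul => //; exact: polyfun_mul.
  by move=> v; rewrite mulrA -RE E big_cons !mulrA.
by exists R1 => // v; rewrite RE R1E big_cons mulrA.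
Qed.

Lemma derivative_dir (K : numFieldType) (V : vectType K) (f : V -> K) u y z :
  polyfun f -> (line f u (y + z))`_1 = (line f u y)`_1 + (line f u z)`_1.
Proof.
have lcst c x : line (fun=> c) u x = c%:P.
  by apply: (@line_uniq _ V) => t; rewrite hornerC.
have llin l x : linform l -> line l u x = (l u)%:P + l x *: 'X.
  move=> ll; apply: (@line_uniq _ V) => t; rewrite !hornerE.
  by rewrite linformD // linformZ // mulrC.
have ladd f1 f2 x : polyfun f1 -> polyfun f2 ->
    line (fun v => f1 v + f2 v) u x = line f1 u x + line f2 u x.
  by move=> p1 p2; apply: (@line_uniq _ V) => t; rewrite hornerD !lineE.
elim=> [c|l ll|f1 f2 p1 IH1 p2 IH2|f1 f2 p1 IH1 p2 IH2].
- by rewrite !lcst coefC addr0.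
- by rewrite !llin // !coefD !coefC !coefZ !coefX /= linformD //; ring.
- by rewrite !ladd // !coefD IH1 IH2; ring.
rewrite !line_mul // !coefM !big_ord_recr !big_ord0 /= !line_coef0 // IH1 IH2; ring.
Qed.

Section Steinberg.
Variables (K : numFieldType) (V : vectType K) (G : seq 'End(V)).
Implicit Types (f l h r : V -> K) (x y z v : V) (g w s q : 'End(V)).
Hypotheses (gG : group_seq G) (refG : generated_by_reflections G).

(** A generic point of the dual space: for [w] moving [p w], the difference
    [phi (p w) - phi (w (p w))] is a nonzero linear function of [phi]. *)
Lemma separating_linform : exists2 l, linform l &
  forall w, w \in G -> w != \1%VF -> exists v, l v != l (w v).
Proof.
have /choice[p pP] w : exists v, w != \1%VF -> w v != v.
  have [->|/eqP nw] := eqVneq w \1%VF; first by exists 0 => /eqP[].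
  apply: contrapT => no; apply: nw; apply/lfunP => v; rewrite id_lfunE.
  by apply: contrapT => /eqP nv; apply: no; exists v.
pose F w (phi : 'Hom(V, K^o)) : K := phi (p w) - phi (w (p w)).
have [|w wr|phi phiP] := @generic_point K 'Hom(V, K^o) _ [seq w <- G | w != \1%VF] F.
- move=> w _; apply: polyfun_lin => a phi psi.
  by rewrite /F !add_lfunE !scale_lfunE /GRing.scale /=; ring.
- move: wr; rewrite mem_filter => /andP[/pP wp _]; rewrite eq_sym in wp.
  have [l ll lw] := linform_neq wp.
  pose lL := GRing.isLinear.Build K V K^o *:%R l ll.
  pose lf : {linear V -> K^o} := HB.pack l lL.
  by exists (linfun lf); rewrite /F !lfunE subr_eq0.
exists (fun v => phi v) => [a x y|w wG w1]; first by rewrite linearP.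
exists (p w); rewrite -subr_eq0; apply: phiP; by rewrite mem_filter w1.
Qed.

(** Sum over [Q] a function separating [v] from the rest of its orbit. At [v] this counts the
    elements of [Q] fixing [v], a nonzero number in characteristic 0; at [w v] a nonzero term would
    put [q \o w] in the stabilizer, hence [w] in [Q]. *)
Lemma separate_orbit (Q : seq 'End(V)) v : group_seq Q -> {subset Q <= G} ->
  (forall w, w \in G -> w v = v -> w \in Q) ->
  exists2 f, invpoly Q f & f v != 0 /\ forall w, w \in G -> w \notin Q -> f (w v) = 0.
Proof.
move=> gQ QG stab; have [k pk [kv k0]] := separate_point v [seq w v | w <- G].
have [uG G1 mG iG] := gG; have [uQ Q1 mQ iQ] := gQ.
exists (fun x => \sum_(q <- Q) k (q x)); last split.
- split; last exact: sum_invariant.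
  by apply: polyfun_sum => q _; exact: polyfun_comp.
- rewrite (bigID (fun q => q v == v)) /= [X in _ + X]big1_seq ?addr0; last first.
    by move=> q /andP[qv qQ]; apply: k0 => //; apply: map_f; exact: QG.
  rewrite (eq_bigr (fun=> 1)) => [|q /eqP->//].
  rewrite -big_filter big_const_seq count_predT iter_addr_0 pnatr_eq0 size_eq0.
  by apply/eqP => E; have := mem_filter (fun q => q v == v) \1%VF Q; rewrite E Q1 id_lfunE eqxx.
move=> w wG wQ; apply: big1_seq => q /= qQ; rewrite -comp_lfunE; apply: k0.
  by apply: map_f; exact: mG (QG _ qQ) wG.
apply: contra wQ => /eqP E.
have qwQ : (q \o w)%VF \in Q by apply: stab => //; exact: mG (QG _ qQ) wG.
have [k' k'Q [_ kq]] := iQ q qQ.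
by rewrite -(comp_lfun1l w) -kq -comp_lfunA; exact: mQ.
Qed.

Lemma free_point n : polyfun n -> (exists v, n v != 0) ->
  exists2 v, n v != 0 & forall w, w \in G -> w v = v -> w = \1%VF.
Proof.
move=> pn nn; have [v [nv vP]] := @generic_stabilizer K V G idfun n pn nn.
exists v => // w wG /(vP w wG) wE; apply/lfunP => z; rewrite id_lfunE; exact: wE.
Qed.

Variable u : V.

(** Membership in X, the intersection of the reflecting hyperplanes through [u]. *)
Definition flat x := forall s, s \in G -> pseudoreflection s -> s u = u -> s x = x.

Definition flat_stab := [seq g : 'End(V) <- G | `[< forall x, flat x -> g x = x >]].

Let Q := flat_stab.

Lemma flat_stabE g : (g \in Q) = (g \in G) && `[< forall x, flat x -> g x = x >].
Proof. by rewrite mem_filter andbC. Qed.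

Let QG : {subset Q <= G}.
Proof. by move=> g; rewrite flat_stabE => /andP[]. Qed.

Let Qfix g x : g \in Q -> flat x -> g x = x.
Proof. by rewrite flat_stabE => /andP[_ /asboolP]; exact. Qed.

Lemma flat_stab_group : group_seq flat_stab.
Proof.
apply: filter_group_seq => //.
- by apply/asboolP => x _; rewrite id_lfunE.
- move=> g h /asboolP Pg /asboolP Ph; apply/asboolP => x fx.
  by rewrite comp_lfunE Ph ?Pg.
move=> g h hg /asboolP Pg; apply/asboolP => x fx.
by rewrite -{1}(Pg x fx) -comp_lfunE hg id_lfunE.
Qed.

Let gQ := flat_stab_group.

Variable T : (V -> K) -> (V -> K).
Hypotheses (T_inv : forall f, polyfun f -> invpoly G (T f))
  (TD : forall f1 f2, polyfun f1 -> polyfun f2 ->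
      forall v, T (fun v => f1 v + f2 v) v = T f1 v + T f2 v)
  (TM : forall a f, invpoly G a -> polyfun f ->
      forall v, T (fun v => a v * f v) v = a v * T f v).

(* T restricted to the Q-invariants is f |-> trace (f r / h). *)
Definition trace_pair h r := [/\ invpoly Q h, invpoly Q r & forall f, invpoly Q f ->
  forall v, T (fun v => f v * h v) v = \sum_(w <- G) f (w v) * r (w v)].

(** At a point [x] with trivial stabilizer where [N] is nonzero, some [f] isolates the terms with
    [w] in [Q]; the two formulas for [T] on [f * h1 * h2] then give [size Q * f x * N x = 0]. *)
Lemma trace_pair_unique h1 r1 h2 r2 : trace_pair h1 r1 -> trace_pair h2 r2 ->
  forall v, r1 v * h2 v = r2 v * h1 v.
Proof.
move=> [i1 j1 E1] [i2 j2 E2].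
pose N v := r1 v * h2 v - r2 v * h1 v.
have iN : invpoly Q N.
  by apply: invpoly_add; [exact: invpoly_mul|apply: invpoly_opp; exact: invpoly_mul].
suff N0 v : N v = 0 by move=> v; apply/eqP; rewrite -subr_eq0 -/(N v) N0.
apply/eqP/negPn/negP => nv; have [x nx xfree] := free_point (proj1 iN) (ex_intro _ v nv).
have [uG G1 mG iG] := gG; have [uQ Q1 mQ iQ] := gQ.
have [|f fi [fx f0]] := @separate_orbit Q x gQ QG.
  by move=> w wG /(xfree w wG) ->.
have : \sum_(w <- G) f (w x) * N (w x) = 0.
  have := E1 _ (invpoly_mul fi i2) x.
  have -> : (fun v => f v * h2 v * h1 v) = fun v => f v * h1 v * h2 v.
    by apply: funext => z; rewrite mulrAC.
  rewrite (E2 _ (invpoly_mul fi i1) x) => /eqP; rewrite eq_sym -subr_eq0 -sumrB => /eqP E.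
  rewrite -[RHS]E; apply: eq_bigr => w _; rewrite /N; ring.
rewrite (bigID (mem Q)) /= [X in _ + X]big1_seq ?addr0; last first.
  by move=> w /andP[wQ wG]; rewrite f0 // mul0r.
rewrite (eq_bigr (fun=> f x * N x)) => [|w wQ]; last first.
  by have [_ ->] := fi => //; have [_ ->] := iN.
rewrite -big_filter big_const_seq count_predT iter_addr_0 => /eqP.
rewrite mulrn_eq0 mulf_eq0 (negPf fx) (negPf nx) !orbF size_eq0 => /eqP E.
by have := mem_filter (mem Q) \1%VF G; rewrite E /= G1 Q1.
Qed.

(** A generic point of the hyperplane [b = 0] has its stabilizer in Q. An [f] separating it from its
    images under the elements outside Q has [different] nonzero there. *)
Lemma trace_pair_at b : linform b -> ~ (forall v, b v = 0) -> b u = 0 ->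
  exists h r, trace_pair h r /\ exists v, b v = 0 /\ h v != 0.
Proof.
move=> lb nb bu; have [pi [e [piE bpi pi_id]]] := linform_proj lb nb.
have [|v [_ vP]] := @generic_stabilizer K V G pi (fun=> 1) (polyfun_cst 1).
  by exists 0; rewrite oner_eq0.
(* An element fixing this point fixes the hyperplane pointwise, so it is a pseudoreflection with
   form [b]; it fixes [u] since [b u = 0], hence fixes X pointwise. *)
have stab w : w \in G -> w (pi v) = pi v -> w \in Q.
  move=> wG /(vP w wG) wpi; rewrite flat_stabE wG; apply/asboolP => x fx; apply: fx => //.
    exists b, (w e - e); split=> // z.
    have -> : z = pi z + b z *: e by rewrite -piE addrC subrK.
    rewrite linearD linearZ /= wpi linformD // linformZ // bpi add0r.
    have -> : b z * b e = b z.
      have := congr1 b (piE z); rewrite linformB // linformZ // bpi subr0 => <-.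
      by [].
    by rewrite opprD addrACA subrr add0r scalerBr.
  by rewrite -(pi_id u bu) wpi.
have [f fi [fv f0]] := separate_orbit gQ QG stab.
have [r ir rE] := lagrange_trace gG gQ QG T_inv TD TM fi.
exists (different G Q f), r; split.
  by split=> //; exact: different_inv.
exists (pi v); split; first exact: bpi.
rewrite /different prodf_seq_neq0; apply/allP => w wG; apply/implyP => wQ.
by rewrite f0 // subr0.
Qed.

Lemma sum_average f (g : V -> K) v : invpoly Q f ->
  \sum_(w <- G) f (w v) * average Q g (w v) = \sum_(w <- G) f (w v) * g (w v).
Proof.
move=> [_ fi]; have sQ := size_group_neq0 gQ; apply: (mulfI sQ); rewrite mulr_sumr.
transitivity (\sum_(w <- G) \sum_(q <- Q) f (w v) * g (q (w v))).
  by apply: eq_bigr => w _; rewrite /average mulrCA mulVKf // mulr_sumr.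
rewrite exchange_big /= big_seq.
rewrite (eq_bigr (fun=> \sum_(w <- G) f (w v) * g (w v))) => [|q qQ].
  by rewrite -big_seq big_const_seq count_predT iter_addr_0 mulr_natl.
rewrite -[RHS](@big_group_mull _ _ _ _ _ G q _ gG (QG qQ)).
by apply: eq_bigr => w _; rewrite comp_lfunE (fi q qQ).
Qed.

Lemma invpoly_prod_conj f : polyfun f -> invpoly Q (fun v => \prod_(q <- Q) f (q v)).
Proof.
move=> pf; split=> [|q qQ v].
  by apply: polyfun_prod => q _; exact: polyfun_comp.
rewrite -[RHS](@big_group_mulr _ _ _ _ _ Q q xpredT _ gQ qQ).
by apply: eq_bigr => p _; rewrite comp_lfunE.
Qed.

(** With the trivial subgroup and a linear form moved by all [w] other than 1, [different] is a
    product of linear forms [l - l \o w]. The pair is made [Q]-invariant by a norm in the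
    denominator and an average in the numerator. *)
Lemma trace_pair_linforms : exists (I : eqType) (s : seq I) (l : I -> V -> K) r,
  (forall i, i \in s -> linform (l i) /\ ~ (forall v, l i v = 0)) /\
  trace_pair (fun v => \prod_(i <- s) l i v) r.
Proof.
have [l ll lsep] := separating_linform.
have [uG G1 mG iG] := gG; have [uQ Q1 mQ iQ] := gQ.
pose Q0 := [:: \1%VF : 'End(V)].
have gQ0 : group_seq Q0.
  have Q01 : \1%VF \in Q0 by exact: mem_head.
  split=> // [g h|g]; rewrite !inE => /eqP->.
    by move=> /eqP->; rewrite comp_lfun1l.
  by exists \1%VF => //; rewrite comp_lfun1l.
have Q0G : {subset Q0 <= G} by move=> g; rewrite inE => /eqP->.
have inv0 f : polyfun f -> invpoly Q0 f.
  by split=> // g; rewrite inE => /eqP-> v; rewrite id_lfunE.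
have il := inv0 _ (polyfun_lin ll).
have [r0 [pr0 _] r0E] := lagrange_trace gG gQ0 Q0G T_inv TD TM il.
pose d := different G Q0 l.
have pd : polyfun d by case: (different_inv gG gQ0 Q0G il).
(* The cofactor of [d] in its norm over [Q]; the formula for the trivial subgroup is applied to
   [f * d1]. *)
pose d1 v := \prod_(q <- Q | q != \1%VF) d (q v).
have pd1 : polyfun d1 by apply: polyfun_prod => q _; exact: polyfun_comp.
pose N (p : 'End(V) * 'End(V)) v := l (p.1 v) - l (p.2 (p.1 v)).
exists _, [seq (q, w) | q <- Q, w <- [seq w <- G | w \notin Q0]], N.
exists (average Q (fun v => d1 v * r0 v)).
have dE : (fun v => \prod_(i <- [seq (q, w) | q <- Q, w <- [seq w <- G | w \notin Q0]]) N i v)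
    = fun v => \prod_(q <- Q) d (q v).
  apply: funext => v; rewrite big_allpairs; apply: eq_bigr => q _.
  by rewrite big_filter.
rewrite dE; split.
  move=> _ /allpairsP[[q w] /= [qQ wG ->]]; split.
    move=> a x y; rewrite /N /= !linearP /= !ll; ring.
  move: wG; rewrite mem_filter inE => /andP[w1 /lsep/(_ w1)[x xw]].
  have [k _ [qk _]] := iQ _ qQ => N0; move: (N0 (k x)).
  by rewrite /N /= -comp_lfunE qk id_lfunE => /eqP; rewrite subr_eq0 (negPf xw).
split; first exact: invpoly_prod_conj.
  by apply: invpoly_average => //; exact: polyfun_mul.
move=> f fi v; rewrite sum_average //.
have -> : (fun v => f v * \prod_(q <- Q) d (q v)) = fun v => (f v * d1 v) * d v.
  by apply: funext => x; rewrite (bigD1_seq \1%VF) //= id_lfunE -/(d1 x); ring.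
rewrite r0E; first by apply: eq_bigr => w _; rewrite mulrA.
by apply: inv0; apply: polyfun_mul => //; case: fi.
Qed.

Lemma trace_pair_unit : exists h r, trace_pair h r /\ h u != 0.
Proof.
have [I [s [l [rD [ls [[pD iD] irD rDE]]]]]] := trace_pair_linforms.
have tD : trace_pair (fun v => \prod_(i <- s) l i v) rD by split.
have [uG G1 mG iG] := gG; have [uQ Q1 mQ iQ] := gQ.
pose D v := \prod_(i <- s) l i v.
(* The factors vanishing at [u] are to be cancelled; [Db] collects the others. *)
pose good i := l i u == 0.
pose Db v := \prod_(i <- [seq i <- s | ~~ good i]) l i v.
have DE v : D v = \prod_(i <- [seq i <- s | good i]) l i v * Db v.
  by rewrite /D (bigID good) /Db !big_filter.
have pDb : polyfun Db.
  apply: polyfun_ext (_ : polyfun (fun v => \prod_(i <- s | (i \in s) && ~~ good i) l i v)) _.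
    by apply: polyfun_prod => i /andP[is_ _]; apply: polyfun_lin; case: (ls i is_).
  by move=> v; rewrite /Db big_filter -big_seq_cond.
have Du : Db u != 0.
  rewrite /Db big_filter prodf_seq_neq0; apply/allP => i _; exact/implyP.
have [i|//|//|i|r1 pr1 r1E] := @linforms_dvd K V I [seq i <- s | good i] l rD Db.
- by rewrite mem_filter => /andP[_ /ls].
- by case: irD.
- rewrite mem_filter => /andP[/eqP gi /ls[li ni]].
  have [h [r [thr [v [lv hv]]]]] := trace_pair_at li ni gi.
  have [[ph _] [pr _] _] := thr.
  exists h, r; split=> //; first by exists v.
  by move=> x; rewrite (trace_pair_unique tD thr) -DE mulrC.
(* To get a [Q]-invariant denominator, the fraction [r1 / Db] is expanded by the other conjugates of
   [Db]. The result [hs] is still nonzero at [u], because [Q] fixes [u]. *)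
pose D1 v := \prod_(q <- Q | q != \1%VF) Db (q v).
have pD1 : polyfun D1 by apply: polyfun_prod => q _; exact: polyfun_comp.
pose hs v := \prod_(q <- Q) Db (q v).
have hsE v : hs v = Db v * D1 v by rewrite /hs (bigD1_seq \1%VF) //= id_lfunE.
have ihs : invpoly Q hs by exact: invpoly_prod_conj.
pose rs v := r1 v * D1 v.
have prs : polyfun rs by exact: polyfun_mul.
have Drs v : D v * rs v = rD v * hs v by rewrite DE hsE r1E /rs; ring.
have Dnz : exists v, D v != 0.
  have [|i is_|v vP] := @generic_point K V I s l.
  - by move=> i /ls[/polyfun_lin].
  - have [_ /existsNP[v nv]] := ls i is_; by exists v; apply/eqP.
  by exists v; rewrite /D prodf_seq_neq0; apply/allP => i is_; rewrite vP.
have nzD : ~ (forall v, D v = 0) by case: Dnz => v + D0; rewrite D0 eqxx.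
(* The norm of [D] over [G] passes through [T]. Multiplying by it reduces the trace formula for [hs]
   to the one for [D], and it is cancelled afterwards. *)
pose delta v := \prod_(w <- G) D (w v).
pose N v := \prod_(w <- G | w != \1%VF) D (w v).
have deltaE v : delta v = D v * N v by rewrite /delta (bigD1_seq \1%VF) //= id_lfunE.
have idelta : invpoly G delta.
  split=> [|g gG' v].
    by apply: polyfun_prod => w _; exact: polyfun_comp.
  rewrite -[RHS](@big_group_mulr _ _ _ _ _ G g xpredT _ gG gG').
  by apply: eq_bigr => w _; rewrite comp_lfunE.
have pN : polyfun N by apply: polyfun_prod => w _; exact: polyfun_comp.
have irs : invpoly Q rs.
  split=> // q qQ v.
  apply: (polyfun_cancel pD (polyfun_comp q prs) prs nzD) => {}v.
  by rewrite -[in LHS](iD q qQ) -!/(D _) !Drs (proj2 irD) // (proj2 ihs).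
have iN : invpoly Q N.
  split=> // q qQ v.
  apply: (polyfun_cancel pD (polyfun_comp q pN) pN nzD) => {}v.
  by rewrite -[in LHS](iD q qQ) -!/(D _) -!deltaE (proj2 idelta) // QG.
exists hs, rs; split; last first.
  rewrite /hs prodf_seq_neq0; apply/allP => q qQ; by rewrite /= Qfix.
split=> // f fi v.
have [pf _] := fi; have [phs _] := ihs.
have pfh : polyfun (fun v => f v * hs v) by exact: polyfun_mul.
have nzd : ~ (forall v, delta v = 0).
  have [|w wG|x xP] := @generic_point K V _ G (fun w v => D (w v)).
  - by move=> w _; exact: polyfun_comp.
  - have [k _ [wk _]] := iG w wG; have [x xD] := Dnz.
    by exists (k x); rewrite -comp_lfunE wk id_lfunE.
  move=> /(_ x)/eqP; rewrite /delta prodf_seq_eq0 => /hasP[w wG /= /eqP w0].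
  by have := xP w wG; rewrite w0 eqxx.
have pS : polyfun (fun v => \sum_(w <- G) f (w v) * rs (w v)).
  by apply: polyfun_sum => w _; apply: polyfun_mul; exact: polyfun_comp.
apply: (polyfun_cancel (proj1 idelta) (proj1 (T_inv pfh)) pS nzd) => {}v.
rewrite -TM //.
have -> : (fun v => delta v * (f v * hs v)) = fun v => (N v * (f v * hs v)) * D v.
  by apply: funext => x; rewrite deltaE; ring.
rewrite rDE; last by apply: invpoly_mul => //; exact: invpoly_mul.
rewrite mulr_sumr big_seq [RHS]big_seq; apply: eq_bigr => w wG.
rewrite -(proj2 idelta w wG) deltaE.
have := Drs (w v); move: (D _) (N _) (rD _) => x y z E.
by rewrite -!mulrA [hs _ * z]mulrC -E; ring.
Qed.

End Steinberg.

(** * Steinberg's theorem on the stabilizer of a point *)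

Section SteinbergTheorem.
Variables (K : numFieldType) (V : vectType K) (G : seq 'End(V)).
Implicit Types (f l h r : V -> K) (x y z v : V) (g w s q : 'End(V)).
Hypotheses (gG : group_seq G) (refG : generated_by_reflections G).
Variable u : V.

(** Elements fixing [u] permute the reflections fixing [u] by conjugation. *)
Lemma flat_comp w x : w \in G -> w u = u -> flat G u x -> flat G u (w x).
Proof.
have [uG G1 mG iG] := gG => wG wu fx s sG [b [rho [lb nb sE]]] su.
have [k kG [wk kw]] := iG w wG.
have kK z : w (k z) = z by rewrite -comp_lfunE wk id_lfunE.
have wK z : k (w z) = z by rewrite -comp_lfunE kw id_lfunE.
have ku : k u = u by rewrite -{1}wu wK.
have := fx (k \o (s \o w))%VF (mG _ _ kG (mG _ _ sG wG)).
rewrite !comp_lfunE wu su ku => H.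
rewrite -[LHS]kK H //.
exists (fun v => b (w v)), (k rho); split.
- exact: linform_comp.
- by move=> b0; apply: nb => v; rewrite -(kK v).
- by move=> v; rewrite !comp_lfunE -linearZ -sE linearB /= wK.
Qed.

Lemma flat_linear a x y : flat G u x -> flat G u y -> flat G u (a *: x + y).
Proof. by move=> fx fy s sG rs su; rewrite linearP /= (fx s) // (fy s). Qed.

Lemma invariant_derivative w f x : w \in G -> w u = u -> invpoly G f ->
  (line f u (w x))`_1 = (line f u x)`_1.
Proof.
move=> wG wu [pf fi]; suff -> : line f u (w x) = line f u x by [].
apply: line_uniq => t; rewrite lineE // -(fi w wG); congr f.
by rewrite linearD linearZ /= wu.
Qed.

Lemma stabilizer_fixes_flat w x : w \in G -> w u = u -> flat G u x -> w x = x.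
Proof.
move=> wG wu fx; apply/eqP/negPn/negP => nwx.
pose y := x - w x.
have y0 : y != 0 by rewrite subr_eq0 eq_sym.
have fy : flat G u y.
  rewrite /y addrC -scaleN1r; apply: flat_linear => //; exact: flat_comp.
(* On invariants the derivatives along [x] and [w x] agree, so the one along [y] vanishes; by
   Leibniz this derivative satisfies the hypotheses of [lift_functional]. *)
have Dinv a : invpoly G a -> (line a u y)`_1 = 0.
  move=> ia; have := derivative_dir u y (w x) (proj1 ia).
  rewrite subrK invariant_derivative // => /eqP.
  by rewrite -subr_eq0 opprD addrCA subrr addr0 oppr_eq0 => /eqP.
have [|a f ia pf|T [T_inv TD TM TE]] := @lift_functional K V G gG refG u
    (fun f => (line f u y)`_1).
- move=> f1 f2 p1 p2; rewrite -coefD (@line_uniq _ _ _ u y (line f1 u y + line f2 u y)) // => t.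
  by rewrite hornerD !lineE.
- rewrite line_mul //; last by case: ia.
  rewrite coefM !big_ord_recr big_ord0 /= (Dinv a ia) mul0r addr0 add0r.
  by rewrite line_coef0 //; case: ia.
have [h [r [[[ph hi] [pr ri] E] hu]]] := trace_pair_unit gG u T_inv TD TM.
pose Q := flat_stab G u.
have QG q : q \in Q -> q \in G by rewrite flat_stabE => /andP[].
have Qfix q z : q \in Q -> flat G u z -> q z = z.
  by rewrite flat_stabE => /andP[_ /asboolP]; exact.
have [l ll ly] := linform_neq0 y0.
have fu : flat G u u by [].
have gQ : group_seq Q by exact: flat_stab_group.
(* A [Q]-invariant function equal to the parameter [t] at [u + t *: y], since [Q] fixes this line
   pointwise. *)
pose a v := average Q l v - average Q l u.
have [pav iav] := invpoly_average gQ (polyfun_lin ll).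
have aE t : a (u + t *: y) = t.
  rewrite /a !average_invariant // => [|q qQ|q qQ]; last 2 first.
  - by rewrite Qfix.
  - by rewrite Qfix // addrC; exact: flat_linear.
  by rewrite linformD // linformZ // ly mulr1 addrC addKr.
have ia : invpoly Q a.
  by split=> [|q qQ v]; [apply: polyfun_sub => //; exact: polyfun_cst|rewrite /a iav].
have [k0 pk0 [k0u k0P]] := separate_point u [seq q u | q <- G].
(* [k] is 1 at [u] and 0 on the rest of the orbit, and [a u = 0]. So all terms of the trace of
   [a * k] at [u] vanish, whereas the derivative of [a * k * h] at [u] along [y] is [h u]. *)
pose k v := \prod_(q <- Q) k0 (q v).
have [pk ik] : invpoly Q k by exact: invpoly_prod_conj.
have ku : k u = 1 by rewrite /k big_seq big1 // => q qQ; rewrite Qfix.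
have [pa _] := ia; have phk : polyfun (fun v => k v * h v) by exact: polyfun_mul.
have pf : polyfun (fun v => a v * k v) by exact: polyfun_mul.
have : (line (fun v => a v * (k v * h v)) u y)`_1 = 0.
  rewrite -TE; last by exact: polyfun_mul.
  have -> : (fun v => a v * (k v * h v)) = fun v => (a v * k v) * h v.
    by apply: funext => v; rewrite mulrA.
  rewrite E; last by apply: invpoly_mul.
  apply: big1_seq => w' /= w'G; have [->|nw'] := eqVneq (w' u) u.
    by have := aE 0; rewrite scale0r addr0 => ->; rewrite !mul0r.
  have [_ Q1 _ _] := gQ.
  rewrite /k (big_rem _ Q1) /= id_lfunE k0P ?mul0r ?mulr0 ?mul0r //.
  exact: map_f.
have -> : line (fun v => a v * (k v * h v)) u y = 'X * line (fun v => k v * h v) u y.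
  rewrite (line_mul u y pa phk); congr (_ * _).
  by apply: line_uniq => t; rewrite hornerX aE.
rewrite mulrC coefMX /= line_coef0 // ku mul1r => /eqP.
by rewrite (negPf hu).
Qed.

End SteinbergTheorem.

(** * Reflection groups *)

Section ReflectionGroups.
Variables (K : numFieldType) (V : vectType K).
Implicit Types (g h w s : 'End(V)) (U H X : {vspace V}).

(** For any [e] moved by [s], V is the direct sum of [H] and the line of [e], so [rho = s e - e]
    spans the image of [s - 1]. *)
Lemma is_reflection_pseudo s H : s <> \1%VF -> is_hyperplane H ->
  fixes_pointwise s H -> exists (b : V -> K) (rho : V),
    [/\ linform b, forall v, (b v = 0) <-> (v \in H), rho != 0
      & forall v, s v - v = b v *: rho].
Proof.
move=> s1 hH sH.
have [e se] : exists e, s e != e.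
  apply: contrapT => no; apply: s1; apply/lfunP => v; rewrite id_lfunE.
  by apply: contrapT => /eqP nv; apply: no; exists v.
have eH : e \notin H by apply: contra se => /sH ->.
have e0 : e != 0 by apply: contra eH => /eqP->; exact: mem0v.
have cap0 : (H :&: <[e]> = 0)%VS.
  apply/eqP; rewrite -subv0; apply/subvP => x; rewrite memv_cap => /andP[xH /vlineP[c xc]].
  rewrite memv0 xc; have [->|c0] := eqVneq c 0; first by rewrite scale0r.
  move: xH; rewrite xc => xH; case/negP: eH.
  by rewrite -[e](scalerK c0) memvZ.
have HeV : (H + <[e]>)%VS = fullv.
  by apply/eqP; rewrite eqEdim subvf -hH dimv_disjoint_sum // dim_vline e0 addn1 /=.
have dec v : exists2 h, h \in H & exists c, v = h + c *: e.
  have : v \in (H + <[e]>)%VS by rewrite HeV memvf.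
  by move=> /memv_addP[h hh [_ /vlineP[c ->] ->]]; exists h => //; exists c.
have [|l ll lE] := @linform_neq0 _ _ (s e - e); first by rewrite subr_eq0.
have bE x c : x \in H -> s (x + c *: e) - (x + c *: e) = c *: (s e - e).
  by move=> xH; rewrite linearD linearZ /= sH // opprD addrACA subrr add0r scalerBr.
exists (fun v => l (s v - v)), (s e - e); split.
- by move=> a x y; rewrite -ll linearP scalerBr opprD addrACA.
- move=> v; have [h hh [c ->]] := dec v; rewrite bE // linformZ // lE mulr1.
  split=> [->|]; first by rewrite scale0r addr0.
  have [//|c0] := eqVneq c 0; rewrite rpredDl // => cH.
  have := memvZ c^-1 cH.
  by rewrite scalerK // (negPf eH).
- by rewrite subr_eq0.
by move=> v; have [h hh [c ->]] := dec v; rewrite bE // linformZ // lE mulr1.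
Qed.

Variable W : set 'End(V).
Hypothesis hW : is_reflection_group W.

Lemma reflection_group_seq : exists2 G : seq 'End(V), group_seq G & W = [set` G].
Proof.
have [[W1 mW iW] /finite_seqP[s Ws] _] := hW.
have WE g : W g <-> g \in s by rewrite Ws.
exists (undup s); last first.
  by rewrite Ws; apply/seteqP; split=> g; rewrite /= mem_undup.
split.
- exact: undup_uniq.
- by rewrite mem_undup; apply/WE.
- by move=> g h; rewrite !mem_undup => /WE gW /WE hW'; apply/WE/mW.
move=> g; rewrite mem_undup => /WE gW; have [/eqP kg gV] := iW g gW.
exists (g^-1)%VF; first by rewrite mem_undup; apply/WE.
by rewrite lker0_compVf // lker0_compfV.
Qed.

Variable G : seq 'End(V).
Hypotheses (gG : group_seq G) (WG : W = [set` G]).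

Let WE g : W g <-> g \in G. Proof. by rewrite WG. Qed.

Lemma reflection_group_generated : generated_by_reflections G.
Proof.
have [[W1 mW iW] _ gen] := hW.
move=> P P1 mP iP rP g /WE gW.
suff /(_ g gW)[_ //] : W `<=` [set g | W g /\ P g].
apply: gen => [|s [sW rs]]; last first.
  split=> //; apply: rP; first exact/WE.
  have [_ s1 _ [H hH sH]] := rs; have [b [rho [lb bH rho0 sE]]] := is_reflection_pseudo s1 hH sH.
  exists b, rho; split=> // b0.
  have := hH; suff -> : H = fullv by move=> /esym; elim: (\dim _) => // n IH [].
  by apply/vspaceP => v; rewrite memvf; apply/bH.
split=> [//|x y [xW Px] [yW Py]|x [xW Px]].
- by split; [exact: mW|apply: mP => //; exact/WE].
have [kx xV] := iW x xW; split=> //; split=> //.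
apply: (iP x) => //; [exact/WE|exact/WE|].
by rewrite lker0_compfV // kx.
Qed.

(** Left multiplication by [g] permutes [G]; [n] is the length of the cycle of the identity. *)
Lemma finite_order g : g \in G -> exists2 n, (0 < n)%N & forall v, iter n g v = v.
Proof.
move=> gG'; have [uG G1 mG iG] := gG; have [k kG [gk kg]] := iG g gG'.
pose f (x : seq_sub G) : seq_sub G := SeqSub (mG _ _ gG' (valP x)).
have fI : injective f.
  move=> x y /(congr1 (fun z => k \o val z)%VF) /=.
  by rewrite !comp_lfunA kg !comp_lfun1l => /val_inj.
have iterE n v : iter n g v = val (iter n f (SeqSub G1)) v.
  by elim: n => [|n IH] /=; rewrite ?id_lfunE // comp_lfunE IH.
exists (fingraph.order f (SeqSub G1)); first exact: fingraph.order_gt0.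
by move=> v; rewrite iterE fingraph.iter_order // id_lfunE.
Qed.

Lemma pseudoreflection_hyperplane s : s \in G -> pseudoreflection s -> s != \1%VF ->
  is_reflection s /\ is_hyperplane (fixedSpace s).
Proof.
move=> sG [b [rho [lb nb sE]]] s1.
have [[_ _ iW] _ _] := hW; have [ks _] := iW s (proj2 (WE s) sG).
have hyp : is_hyperplane (fixedSpace s).
  have := limg_ker_dim (s - \1%VF) fullv.
  rewrite capfv -/(fixedSpace s) /is_hyperplane => <-; rewrite -addn1; congr (_ + _)%N.
  have img x : (s - \1%VF) x = b x *: rho.
    by rewrite add_lfunE opp_lfunE id_lfunE sE.
  have /existsNP[e /eqP be] := nb.
  have rho0 : rho != 0.
    apply: contra s1 => /eqP r0; apply/eqP/lfunP => v; apply/eqP.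
    by rewrite id_lfunE -subr_eq0 sE r0 scaler0.
  suff -> : ((s - \1%VF) @: fullv)%VS = <[rho]>%VS by rewrite dim_vline rho0.
  apply/eqP; rewrite eqEsubv; apply/andP; split.
    apply/subvP => _ /memv_imgP[x _ ->]; rewrite img; exact: memvZ (memv_line _).
  rewrite -memvE; apply/memv_imgP; exists ((b e)^-1 *: e); first exact: memvf.
  by rewrite linearZ /= img scalerA mulVf // scale1r.
split=> //; split=> //; first exact/eqP.
- exact: finite_order.
by exists (fixedSpace s) => // v /fixedSpaceP.
Qed.

Lemma fixed_hyperplane s H : s <> \1%VF -> is_hyperplane H -> fixes_pointwise s H ->
  fixedSpace s = H.
Proof.
move=> s1 hH sH; have [b [rho [lb bH rho0 sE]]] := is_reflection_pseudo s1 hH sH.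
apply/vspaceP => v; apply/fixedSpaceP/idP => [sv|/sH//].
apply/bH/eqP; have := sE v; rewrite sv subrr => /esym/eqP.
by rewrite scaler_eq0 (negPf rho0) orbF.
Qed.

(** Let [u] be generic in [U], so that whatever in [G] fixes [u] fixes [U] pointwise. The reflecting
    hyperplanes through [u] are then those containing [U], and Steinberg's theorem at [u] shows that
    [w] fixes their intersection. *)
Lemma fixedSpace_in_lattice w : W w -> intersection_lattice W (fixedSpace w).
Proof.
move=> /WE wG; set U := fixedSpace w.
have [|v [_ vP]] := @generic_stabilizer K V G (projv U) (fun=> 1) (polyfun_cst 1).
  by exists 0; rewrite oner_eq0.
pose u := projv U v.
have uU : u \in U by exact: memv_proj.
pose P s := `[< is_reflection s >] && (U <= fixedSpace s)%VS.
exists [seq fixedSpace s | s <- G & P s].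
  move=> H /mapP[s]; rewrite mem_filter => /andP[/andP[/asboolP rs Us] sG] ->.
  have [_ s1 _ [H' hH' sH']] := rs; rewrite (fixed_hyperplane s1 hH' sH').
  by split=> //; exists s; split=> //; exact/WE.
have inX x : reflect (forall s, s \in G -> P s -> s x = x)
    (x \in (\bigcap_(H <- [seq fixedSpace s | s <- G & P s]) H)%VS).
  rewrite big_map big_filter big_seq_cond; apply: (iffP idP) => [|H].
    rewrite memvE => xX s sG Ps; apply/fixedSpaceP; rewrite memvE; apply: subv_trans xX _.
    rewrite -big_seq_cond (big_rem _ sG) Ps; exact: capvSl.
  elim/big_ind: _ => [|A B xA xB|s /andP[sG Ps]].
  - exact: memvf.
  - by rewrite memv_cap xA xB.
  by apply/fixedSpaceP; exact: H.
apply/vspaceP => x; apply/idP/inX => [xU s _ /andP[_ /subvP/(_ x xU)/fixedSpaceP]//|H].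
apply/fixedSpaceP; apply: (stabilizer_fixes_flat gG reflection_group_generated wG (u := u)).
  exact/fixedSpaceP.
move=> s sG ps su; have [->|s1] := eqVneq s \1%VF; first by rewrite id_lfunE.
apply: H => //; have [rs _] := pseudoreflection_hyperplane sG ps s1.
rewrite /P; apply/andP; split; first exact/asboolP.
apply/subvP => z zU; apply/fixedSpaceP.
by rewrite -(projv_id zU); apply: vP.
Qed.

End ReflectionGroups.

(** * Eigenspaces *)

Lemma leigenspaceP (K : fieldType) (V : vectType K) (g : 'End(V)) (a : K) v :
  reflect (g v = a *: v) (v \in passmx.leigenspace g a).
Proof.
rewrite memv_ker add_lfunE opp_lfunE scale_lfunE id_lfunE subr_eq0; exact: eqP.
Qed.

(** * An invariant hermitian form *)

Section HermitianForm.
Variables (K : numClosedFieldType) (V : vectType K) (G : seq 'End(V)).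
Hypothesis gG : group_seq G.

Definition herm (x y : V) : K := \sum_(w <- G) \sum_(i < \dim {:V})
  coord (vbasis {:V}) i (w x) * (coord (vbasis {:V}) i (w y))^*.

Lemma hermDl x y z : herm (x + y) z = herm x z + herm y z.
Proof.
rewrite -big_split; apply: eq_bigr => w _; rewrite -big_split; apply: eq_bigr => i _.
by rewrite !linearD mulrDl.
Qed.

Lemma hermDr x y z : herm x (y + z) = herm x y + herm x z.
Proof.
rewrite -big_split; apply: eq_bigr => w _; rewrite -big_split; apply: eq_bigr => i _.
by rewrite !linearD rmorphD mulrDr.
Qed.

Lemma hermZ a x y : herm (a *: x) (a *: y) = a * a^* * herm x y.
Proof.
rewrite mulr_sumr; apply: eq_bigr => w _; rewrite mulr_sumr; apply: eq_bigr => i _.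
by rewrite !linearZ /= rmorphM; ring.
Qed.

Lemma herm_conj x y : (herm x y)^* = herm y x.
Proof.
rewrite rmorph_sum; apply: eq_bigr => w _; rewrite rmorph_sum; apply: eq_bigr => i _.
by rewrite rmorphM /= conjCK mulrC.
Qed.

Lemma hermG g x y : g \in G -> herm (g x) (g y) = herm x y.
Proof.
move=> gG'; rewrite -[RHS](@big_group_mulr _ _ _ _ _ G g xpredT _ gG gG').
by apply: eq_bigr => w _; rewrite !comp_lfunE.
Qed.

Lemma herm_eq0 x : herm x x = 0 -> x = 0.
Proof.
have [uG G1 mG iG] := gG; have nn (w : 'End(V)) : 0 <= \sum_(i < \dim {:V})
    coord (vbasis {:V}) i (w x) * (coord (vbasis {:V}) i (w x))^*.
  by apply: sumr_ge0 => i _; exact: mul_conjC_ge0.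
rewrite /herm (big_rem _ G1) /= => /eqP; rewrite paddr_eq0 //; last exact: sumr_ge0.
case/andP => /eqP c0 _; rewrite (coord_vbasis (memvf x)) big1 // => i _.
have /(_ i isT)/eqP := psumr_eq0P (fun i _ => mul_conjC_ge0 _) c0.
by rewrite id_lfunE mul_conjC_eq0 => /eqP ->; rewrite scale0r.
Qed.

(* An element y of the zeta-eigenspace of g is orthogonal to s v - v, as
   (y, v) = (g y, g (s v)) = (y, s v) up to the unit zeta; were y moved by s,
   its displacement would be a multiple of s v - v orthogonal to y. *)
Lemma eigenvector_reflection (zeta : K) g s y v : zeta * zeta^* = 1 ->
  g \in G -> s \in G -> pseudoreflection s -> g y = zeta *: y -> s y != y ->
  g (s v) = zeta *: v -> s v = v.
Proof.
move=> z1 gG' sG [b [rho [lb nb sE]]] gy sy gsv; apply/eqP/negPn/negP => sv.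
have bv : b v != 0 by apply: contra sv => /eqP bv; rewrite -subr_eq0 sE bv scale0r.
have yd : herm y (s v - v) = 0.
  apply: (@addrI _ (herm y v)); rewrite -hermDr addrC subrK addr0.
  by rewrite -(hermG _ _ gG') gy gsv hermZ z1 mul1r.
have dE : s y - y = (b y / b v) *: (s v - v) by rewrite !sE scalerA divfK.
have yd2 : herm y (s y - y) = 0.
  rewrite dE; have := yd; rewrite /herm => yd'.
  transitivity ((b y / b v)^* * herm y (s v - v)); last by rewrite yd mulr0.
  rewrite mulr_sumr; apply: eq_bigr => w _; rewrite mulr_sumr; apply: eq_bigr => i _.
  by rewrite !linearZ /= rmorphM mulrCA.
have dy : herm (s y - y) y = 0 by rewrite -herm_conj yd2 rmorph0.
have sd : s y = y + (s y - y) by rewrite addrC subrK.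
have dn : s y - y != 0 by rewrite subr_eq0.
(* [s y] is [y] plus an orthogonal vector [d] and has the same norm, so [d = 0]. *)
have := hermG y y sG; move: (s y - y) sd yd2 dy dn => d -> yd2 dy dn.
rewrite hermDl !hermDr yd2 dy add0r addr0 -[RHS]addr0 => /addrI/herm_eq0/eqP.
by rewrite (negPf dn).
Qed.

End HermitianForm.

Lemma hyperplane_capv_dim (K : fieldType) (V : vectType K) (U H : {vspace V}) :
  is_hyperplane H -> ~~ (U <= H)%VS -> (\dim (U :&: H)).+1 = \dim U.
Proof.
move=> hH nUH; have := dimv_sum_cap U H.
have -> : (U + H)%VS = fullv.
  apply/eqP; rewrite eqEdim subvf -hH ltn_neqAle dimvS ?addvSr // andbT.
  by rewrite (dimv_leqif_eq (addvSr U H)); apply: contra nUH => /eqP->; exact: addvSl.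
by rewrite /is_hyperplane in hH; lia.
Qed.

(** * The poset of eigenspaces *)

Section Eigenspaces.
Variables (K : numClosedFieldType) (V : vectType K) (W : set 'End(V)) (zeta : K).
Hypotheses (hW : is_reflection_group W) (zeta1 : zeta * zeta^* = 1).
Implicit Types (x y z E F H X U : {vspace V}).

Local Notation EW := (eigenspaces W zeta).

Lemma eigenspaces_cap_hyperplane F H : EW F -> reflecting_hyperplane W H ->
  EW (F :&: H)%VS.
Proof.
move=> [g gW <-] [hH [s [sW rs sH]]]; have [_ s1 _ _] := rs.
have [G gG WG] := reflection_group_seq hW.
set Fg := passmx.leigenspace _ _.
have [/capv_idPl->|/subvPn[y yF yH]] := boolP (Fg <= H)%VS; first by exists g.
have fsH := fixed_hyperplane s1 hH sH.
have [_ mW _] : is_subgroup_GL W by case: hW.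
(* Here some eigenvector [y] of [g] is moved by [s], which forces the [zeta]-eigenvectors of
   [g \o s] into [H]. *)
exists (g \o s)%VF; first exact: mW.
have WE h : W h -> h \in G by rewrite WG.
have [b [rho [lb bH rho0 sE]]] := is_reflection_pseudo s1 hH sH.
have ps : pseudoreflection s.
  by exists b, rho; split=> // b0; case/negP: yH; apply/bH.
apply/vspaceP => v; rewrite memv_cap; apply/leigenspaceP/andP => [|[/leigenspaceP gv /sH sv]].
  rewrite comp_lfunE => gsv.
  have sv : s v = v.
    apply: (eigenvector_reflection gG zeta1 (WE _ gW) (WE _ sW) ps (y := y)) => //.
      exact/leigenspaceP.
    by apply: contra yH => /eqP/fixedSpaceP; rewrite fsH.
  by split; [apply/leigenspaceP; rewrite -{1}sv|rewrite -fsH; exact/fixedSpaceP].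
by rewrite comp_lfunE sv.
Qed.

Lemma eigenspaces_cap F X : EW F -> intersection_lattice W X -> EW (F :&: X)%VS.
Proof.
move=> EF [s sH ->]; elim: s sH F EF => [|H s IH] sH F EF.
  by rewrite big_nil capvf.
rewrite big_cons capvA; apply: IH => [H' H's|]; first by apply: sH; rewrite inE H's orbT.
by apply: eigenspaces_cap_hyperplane => //; apply: sH; exact: mem_head.
Qed.

(** On [E] the conditions [h v = zeta *: v] and [h v = g v] coincide. The lemma serves both with [E]
    maximal and with [E] the bottom of an interval. *)
Lemma eigenspaces_subv F E : EW F -> EW E -> (F <= E)%VS ->
  exists2 X, intersection_lattice W X & F = (E :&: X)%VS.
Proof.
move=> [h hW' <-] [g gW <-] sub; have [[W1 mW iW] _ _] := hW.
have [/eqP kg gVW] := iW g gW; have gK := lker0_lfunK kg; have gVK := lker0_lfunVK kg.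
have [G gG WG] := reflection_group_seq hW.
exists (fixedSpace (g^-1 \o h)%VF).
  by apply: (fixedSpace_in_lattice hW gG WG); exact: mW.
apply/vspaceP => v; rewrite memv_cap; apply/idP/andP => [vF|[/leigenspaceP gv /fixedSpaceP]].
  have vE := subvP sub v vF; split=> //; apply/fixedSpaceP; rewrite comp_lfunE.
  by rewrite (leigenspaceP _ _ _ vF) -(leigenspaceP _ _ _ vE) gK.
rewrite comp_lfunE => gh; apply/leigenspaceP.
by rewrite -gv -{2}gh gVK.
Qed.

Lemma maximal_eigenspace_above F : EW F ->
  exists2 E, maximal_eigenspace W zeta E & (F <= E)%VS.
Proof.
have [n] := ubnP (\dim {:V} - \dim F); elim: n F => // n IH F ltn EF.
have [mF|] := pselect (maximal_eigenspace W zeta F); first by exists F.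
move=> /not_andP[//|/existsNP[E /not_implyP[EE /not_implyP[FE /eqP nFE]]]].
have [||E' mE' EE'] := IH E; [|by []|by exists E' => //; exact: subv_trans EE'].
have dFE : (\dim F < \dim E)%N.
  by rewrite ltn_neqAle dimvS // andbT (dimv_leqif_eq FE) eq_sym.
have := dimvS (subvf E); lia.
Qed.

Lemma eigenspacesE : EW =
  [set F | exists E X, [/\ intersection_lattice W X, maximal_eigenspace W zeta E
                         & F = (E :&: X)%VS]].
Proof.
apply/seteqP; split=> F /=; last by move=> [E [X [LX [EE _] ->]]]; exact: eigenspaces_cap.
move=> EF; have [E mE FE] := maximal_eigenspace_above EF.
have [X LX FX] := eigenspaces_subv EF (proj1 mE) FE.
by exists E, X.
Qed.

(** An eigenspace of least dimension lies in every reflecting hyperplane, hence is fixed pointwise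
    by [W]. Its vectors thus satisfy [v = zeta *: v], and lie in every eigenspace. *)
Lemma eigenspaces_top : exists top, is_top (@rev_incl K V) EW top.
Proof.
have [[W1 mW iW] _ gen] := hW.
pose P n := `[< exists2 F, EW F & \dim F = n >].
have exP : exists n, P n.
  exists (\dim (passmx.leigenspace (\1%VF : 'End(V)) zeta)); apply/asboolP.
  by exists (passmx.leigenspace (\1%VF : 'End(V)) zeta) => //; exists \1%VF.
have [n /asboolP[T ET dT] nmin] := ex_minnP exP.
have TH H : reflecting_hyperplane W H -> (T <= H)%VS.
  move=> rH; have EH := eigenspaces_cap_hyperplane ET rH.
  have dTH : P (\dim (T :&: H)%VS) by apply/asboolP; exists (T :&: H)%VS.
  apply/capv_idPl/eqP; rewrite eqEdim capvSl dT; exact: nmin.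
have Tfix g v : W g -> v \in T -> g v = v.
  move=> + vT; suff sub : W `<=` [set g | W g /\ g v = v] by move=> /sub[].
  apply: gen => [|s [sW rs]]; last first.
    split=> //; have [_ _ _ [H hH sH]] := rs.
    have sub : (T <= H)%VS by apply: TH; split=> //; exists s; split.
    exact: sH _ (subvP sub v vT).
  split=> [|h k [hW' hv] [kW kv]|h [hW' hv]].
  - by split=> //; rewrite id_lfunE.
  - by split; [exact: mW|rewrite comp_lfunE kv].
  have [kh hV] := iW h hW'; split=> //; split=> //.
  by rewrite -{1}hv lker0_lfunK //; exact/eqP.
exists T; split=> // _ [g gW <-]; apply/subvP => v vT; apply/leigenspaceP.
case: ET (vT) => h hW' <- /leigenspaceP; rewrite (Tfix h) // => <-.
exact: Tfix.
Qed.

(** * Upper intervals *)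

Section Interval.
Variables (top x : {vspace V}).
Hypotheses (htop : is_top (@rev_incl K V) EW top) (Ex : EW x).

Let A := interval_in (@rev_incl K V) EW x top.

Let AE z : A z <-> EW z /\ (z <= x)%VS.
Proof. by split=> [[]//|[Ez zx]]; split=> //; apply: htop.2. Qed.

Let A_flat z : A z -> exists2 s : seq {vspace V},
  (forall H, H \in s -> reflecting_hyperplane W H) & z = (x :&: \bigcap_(H <- s) H)%VS.
Proof.
move=> /AE[Ez zx]; have [X [s sH ->] zE] := eigenspaces_subv Ez Ex zx.
by exists s.
Qed.

Let A_cap y H : A y -> reflecting_hyperplane W H -> A (y :&: H)%VS.
Proof.
move=> /AE[Ey yx] rH; apply/AE; split; first exact: eigenspaces_cap_hyperplane.
exact: subv_trans (capvSl _ _) yx.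
Qed.

Let A_capv y z : A y -> A z -> A (y :&: z)%VS.
Proof.
move=> /AE[Ey yx] /AE[Ez zx].
have [X LX ->] := eigenspaces_subv Ez Ex zx.
rewrite capvA (capv_idPl yx); apply/AE; split; first exact: eigenspaces_cap.
exact: subv_trans (capvSl _ _) yx.
Qed.

Let subv_flat (U : {vspace V}) s :
  (forall H : {vspace V}, H \in s -> (U <= H)%VS) -> (U <= \bigcap_(H <- s) H)%VS.
Proof.
move=> sub; rewrite big_seq; elim/big_ind: _ => [|H1 H2 U1 U2|H /sub//].
  exact: subvf.
by rewrite subv_cap U1 U2.
Qed.

Let flat_subv s (H : {vspace V}) : H \in s -> (\bigcap_(H <- s) H <= H)%VS.
Proof. by move=> Hs; rewrite (big_rem _ Hs) capvSl. Qed.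

Lemma interval_join y z j : A y -> A z ->
  is_join (@rev_incl K V) A [set y; z] j -> j = (y :&: z)%VS.
Proof.
move=> Ay Az [Aj jub jleast]; apply/eqP; rewrite eqEsubv subv_cap.
rewrite (jub y) ?(jub z) /=; [|by right|by left].
by apply: jleast => [|_ [->|->]]; [exact: A_capv|exact: capvSl|exact: capvSr].
Qed.

(** In the arrangement cut out on [x] by the reflecting hyperplanes, joins are intersections, the
    proper [x :&: H] are atoms, and the rank is the codimension in [x]. *)
Lemma interval_geometric : geometric_lattice (@rev_incl K V) A.
Proof.
have Ax : A x by apply/AE.
have bot_x : is_bottom (@rev_incl K V) A x by split=> // z /AE[].
have hdim y H : reflecting_hyperplane W H -> ~~ (y <= H)%VS ->
    (\dim (y :&: H)).+1 = \dim y by move=> [hH _]; exact: hyperplane_capv_dim.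
split.
- apply: (@sub_finite_set _ A EW) => [z /AE[]//|].
  by apply: finite_image; have [_ + _] := hW.
- by exists x.
- split.
    split=> [y _|y z _ _ zy yz|y z t _ _ _ zy tz]; first exact: subvv.
      by apply/eqP; rewrite eqEsubv; apply/andP.
    exact: subv_trans tz zy.
  move=> y z Ay Az; split.
    exists (y :&: z)%VS; split; first exact: A_capv.
      by move=> _ [->|->]; [exact: capvSl|exact: capvSr].
    move=> u Au ub; rewrite /rev_incl subv_cap.
    by apply/andP; split; apply: ub; [left|right].
  (* The meet is an element of least dimension containing [y] and [z]: intersecting it with another
     lower bound cannot make it smaller. *)
  pose P n := `[< exists2 t, [/\ A t, (y <= t)%VS & (z <= t)%VS] & \dim t = n >].
  have exP : exists n, P n.
    exists (\dim x); apply/asboolP; exists x => //.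
    by split=> //; [case/AE: Ay|case/AE: Az].
  have [n /asboolP[m [Am ym zm] dm] nmin] := ex_minnP exP.
  exists m; split=> // [_ [->|->] //|l Al lb].
  have Pml : P (\dim (m :&: l)%VS).
    apply/asboolP; exists (m :&: l)%VS => //; split; first exact: A_capv.
      by rewrite subv_cap ym; apply: lb; left.
    by rewrite subv_cap zm; apply: lb; right.
  apply/capv_idPl/eqP; rewrite eqEdim capvSl dm; exact: nmin.
(* All atoms below [z] are taken; among them, the traces on [x] of the hyperplanes defining [z]
   already force the join. *)
- move=> z Az; exists [set a | is_atom (@rev_incl K V) A a /\ (z <= a)%VS].
    by move=> a [].
  split=> // [a []//|u Au ub].
  have [s sH zE] := A_flat Az; have [_ ux] := proj1 (AE u) Au.
  rewrite /rev_incl zE subv_cap ux /=; apply: subv_flat => H Hs.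
  have [xH|nxH] := boolP (x <= H)%VS; first exact: subv_trans ux xH.
  apply: subv_trans (capvSr x H); apply: ub; split; last first.
    by rewrite zE; apply: capvS (subvv x) (flat_subv Hs).
  have dxH := hdim x H (sH H Hs) nxH.
  exists x => //; split=> //.
  + exact: A_cap (sH H Hs).
  + exact: capvSl.
  + by move=> E; move: dxH; rewrite -E => /eqP; rewrite -[X in _ == X]add0n -addn1 addnC eqn_add2r.
  move=> y Ay xy yxH; rewrite /rev_incl in xy yxH.
  have [yx|nyx] := eqVneq y x; [by left|right].
  apply/eqP; rewrite eq_sym eqEdim yxH /= -ltnS dxH.
  by rewrite ltn_neqAle dimvS // andbT (dimv_leqif_eq xy).
exists (fun z => (\dim x - \dim z)%N).
  split=> [b [Ab bbot]|y z [Ay Az zy nyz cov]].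
    have /AE[_ bx] := Ab.
    suff -> : b = x by rewrite subnn.
    by apply/eqP; rewrite eqEsubv bx; exact: bbot.
  have [s sH zE] := A_flat Az; have /AE[_ yx] := Ay; rewrite /rev_incl in zy.
  (* A hyperplane through [z] not containing [y] cuts [y] in an element one dimension smaller,
     between [y] and [z], which must therefore be [z]. *)
  have [H Hs nyH] : exists2 H, H \in s & ~~ (y <= H)%VS.
    apply: contrapT => no; apply: nyz; apply/eqP; rewrite eqEsubv zy andbT zE subv_cap yx.
    by apply: subv_flat => H Hs; apply/negPn/negP => nyH; apply: no; exists H.
  have dyH := hdim y H (sH H Hs) nyH.
  have [||yHy|zyH] := cov (y :&: H)%VS (A_cap Ay (sH H Hs)).
  + exact: capvSl.
  + by rewrite /rev_incl subv_cap zy zE; apply: subv_trans (capvSr _ _) (flat_subv Hs).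
  + by case/negP: nyH; apply/capv_idPl.
  by have := dimvS yx; rewrite -zyH; lia.
move=> y z j m Ay Az /(interval_join Ay Az) -> [Am mlb _].
have /AE[_ yx] := Ay; have /AE[_ zx] := Az; have /AE[_ mx] := Am.
(* The meet contains [y + z] and the join is [y :&: z], so semimodularity follows from the dimension
   formula. *)
have sm : (y + z <= m)%VS by rewrite subv_add (mlb y) ?(mlb z) //; [right|left].
have d1 := dimv_sum_cap y z; have d2 := dimvS sm.
have d3 := dimvS yx; have d4 := dimvS zx; have d5 := dimvS mx.
have d6 := dimvS (subv_trans (capvSl y z) yx).
lia.
Qed.

End Interval.
End Eigenspaces.

Lemma prim_root_mul_conj (K : numClosedFieldType) d (zeta : K) :
  d.-primitive_root zeta -> zeta * zeta^* = 1.
Proof.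
move=> dz; rewrite -normCK; suff /eqP-> : `|zeta| == 1 by rewrite expr1n.
rewrite -(@pexpr_eq1 _ _ d) ?(prim_order_gt0 dz) //.
by rewrite -normrX (prim_expr_order dz) normr1.
Qed.

Local Open Scope complex_scope.

Theorem theorem1p2 (R : realType) (V : vectType R[i]) (W : set 'End(V))
    (d : nat) (zeta : R[i])
    (hW : is_reflection_group W) (hzeta : d.-primitive_root zeta) :
  eigenspaces W zeta =
    [set F | exists E X, [/\ intersection_lattice W X,
                            maximal_eigenspace W zeta E
                          & F = (E :&: X)%VS]] /\
  exists2 top : {vspace V},
    is_top (@rev_incl _ V) (eigenspaces W zeta) top &
    forall x, eigenspaces W zeta x ->
      geometric_lattice (@rev_incl _ V)
        (interval_in (@rev_incl _ V) (eigenspaces W zeta) x top).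
Proof.
have zeta1 := prim_root_mul_conj hzeta.
split; first exact: eigenspacesE hW zeta1.
have [top htop] := eigenspaces_top hW zeta1.
by exists top => // x Ex; exact: (interval_geometric hW zeta1 htop).
Qed.
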